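(* For an infinite dimensional Banach space $E$, the following statements are equivalent: (1) $E$ contains uniformly complemented subspaces isomorphic to $\ell_1^n$ (uniformly in $n\in\mathbb N$). (2) $\mathrm{FBL}[E]$ contains uniformly lattice-complemented sublattices isomorphic to $\ell_1^n$. (3) $\mathrm{FBL}[E]$ contains sublattices $\ell_1^n$ uniformly. (4) $E^*$ has trivial cotype. (5) $\mathrm{FBL}[E]$ fails to be $p$-convex for any $p>1$. (6) $\mathrm{FBL}[E]$ contains uniformly complemented subspaces isomorphic to $\ell_1^n$. (7) $\mathrm{FBL}[E]^*$ has trivial cotype.
   Context: Banach spaces are real. $H[E]$ is the vector lattice (pointwise operations) of positively homogeneous functions $f:E^*\to\mathbb R$, with $\|f\|_{\mathrm{FBL}[E]}=\sup\{\sum_{k=1}^n|f(x_k^* )|: n\in\mathbb N,\ x_1^*,\dots,x_n^*\in E^*,\ \sup_{x\in B_E}\sum_{k=1}^n|x_k^*(x)|\le 1\}$. For $x\in E$ let $\delta_x(x^* )=x^*(x)$. $\mathrm{FBL}[E]$ is the closure, in the space of $f\in H[E]$ with finite norm, of the sublattice generated by $\{\delta_x:x\in E\}$. A Banach space $X$ contains uniformly complemented subspaces isomorphic to $\ell_1^n$ if there are a constant $K$ and, for every $n$, a subspace $X_n\subseteq X$, an isomorphism $u_n:\ell_1^n\to X_n$ with $\|u_n\|\|u_n^{-1}\|\le K$, and a projection of $X$ onto $X_n$ of norm at most $K$. A Banach lattice $X$ contains sublattices $\ell_1^n$ uniformly if there are lattice isomorphisms $u_n:\ell_1^n\to X_n$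 onto sublattices $X_n\subseteq X$ with $\sup_n\|u_n\|\|u_n^{-1}\|<\infty$; they are uniformly lattice-complemented if in addition there are idempotent lattice homomorphisms of $X$ onto $X_n$ with uniformly bounded norms. Trivial cotype means not having cotype $q$ for any $q<\infty$. A Banach lattice $X$ is $p$-convex if for some $M$, $\|(\sum_k|x_k|^p)^{1/p}\|\le M(\sum_k\|x_k\|^p)^{1/p}$ for all finite families (with suprema/maxima if $p=\infty$). *)

(* Defs.v *)
From HB Require Import structures.
From mathcomp Require Import all_boot all_order all_algebra.
From mathcomp Require Import all_classical all_reals all_analysis.

Set Implicit Arguments.
Unset Strict Implicit.
Unset Printing Implicit Defensive.

Import Order.TTheory GRing.Theory Num.Theory.
Import numFieldNormedType.Exports.

Local Open Scope classical_set_scope.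
Local Open Scope ring_scope.

Section opnorm.
Context {R : realType} {X Y : normedModType R}.

(* The norm of [f] restricted to [D]; it is [+oo] when [f] is unbounded there. *)
Definition opnorm (D : set X) (f : X -> Y) : \bar R :=
  ereal_sup [set (`|f x|)%:E | x in [set x | D x /\ `|x| <= 1]].

Lemma opnorm_leP (f : {linear X -> Y}) (c : R) : 0 <= c ->
  (opnorm setT f <= c%:E)%E <-> forall x, `|f x| <= c * `|x|.
Proof.
move=> c0; split=> [fc x|fc]; last first.
  apply: ge_ereal_sup => _ [x [_ x1] <-]; rewrite lee_fin (le_trans (fc x))//.
  by rewrite -[leRHS]mulr1 ler_wpM2l.
have [->|x0] := eqVneq x 0; first by rewrite raddf0 !normr0 mulr0.
have nx0 : 0 < `|x| by rewrite normr_gt0.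
have : `|f (`|x|^-1 *: x)| <= c.
  rewrite -lee_fin (le_trans _ fc)//; apply: ereal_sup_ubound => /=.
  exists (`|x|^-1 *: x) => //; split=> //.
  by rewrite normrZ ger0_norm ?invr_ge0// mulVf ?gt_eqF.
by rewrite linearZ/= normrZ ger0_norm ?invr_ge0// ler_pdivrMl// mulrC.
Qed.

Lemma opnorm_ge0 (f : {linear X -> Y}) : (0 <= opnorm setT f)%E.
Proof.
apply: ereal_sup_ubound; exists 0; last by rewrite raddf0 normr0.
by rewrite /= normr0.
Qed.

Lemma opnorm_fin_num (f : {linear X -> Y}) :
  continuous f -> opnorm setT f \is a fin_num.
Proof.
move=> /linear_bounded_continuous/linear_boundedP fb.
have [c c0 fc] : exists2 c, 0 <= c & forall x, `|f x| <= c * `|x|.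
  near (pinfty_nbhs R) => r; exists r; last by near: r.
  by near: r; exact: nbhs_pinfty_ge.
rewrite ge0_fin_numE ?opnorm_ge0//.
by rewrite (le_lt_trans _ (ltry c))//; apply/opnorm_leP.
Unshelve. all: by end_near. Qed.

End opnorm.

Section dual.
Context {R : realType} (E : normedModType R).

Definition dual_pred : {pred E -> R} :=
  mem [set f : E -> R | linear f /\ continuous f].

Record dual := Dual { dual_fun :> E -> R; dual_funP : dual_fun \in dual_pred }.

HB.instance Definition _ := [isSub for dual_fun].
HB.instance Definition _ := [Choice of dual by <:].

Lemma dual_submod_closed : submod_closed dual_pred.
Proof.
split.
  rewrite inE; split=> [a x y|]; first by rewrite /= scaler0 addr0.
  exact: cst_continuous.
move=> a f g; rewrite !inE => -[fl fc] [gl gc]; split.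
  move=> b x y /=; rewrite !fctE fl gl !scalerDr addrACA; congr (_ + _ + _).
  by rewrite !scalerA mulrC.
have -> : a *: f + g = (fun x => a *: f x + g x) by [].
by move=> x; apply: cvgD; [apply: cvgZl_tmp; exact: fc|exact: gc].
Qed.

HB.instance Definition _ :=
  GRing.isSubmodClosed.Build R (E -> R) dual_pred dual_submod_closed.
HB.instance Definition _ := [SubChoice_isSubLmodule of dual by <:].

Lemma dual_linear (f : dual) : linear f.
Proof. by have := dual_funP f; rewrite inE => -[]. Qed.

HB.instance Definition _ (f : dual) :=
  GRing.isLinear.Build R E R _ (dual_fun f) (dual_linear f).

Lemma dual_continuous (f : dual) : continuous f.
Proof. by have := dual_funP f; rewrite inE => -[]. Qed.

Lemma dualD (f g : dual) x : (f + g) x = f x + g x. Proof. by []. Qed.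

Lemma dualZ a (f : dual) x : (a *: f) x = a * f x. Proof. by []. Qed.

Implicit Types f g : dual.

Definition dual_norm f : R := fine (opnorm setT f).

Lemma dual_normE f : (dual_norm f)%:E = opnorm setT f.
Proof. by rewrite fineK//; apply/opnorm_fin_num/dual_continuous. Qed.

Lemma dual_norm_ge0 f : 0 <= dual_norm f.
Proof. by rewrite -lee_fin dual_normE opnorm_ge0. Qed.

Lemma dual_norm_le f c : 0 <= c ->
  dual_norm f <= c <-> forall x, `|f x| <= c * `|x|.
Proof. by move=> c0; rewrite -lee_fin dual_normE; exact: opnorm_leP. Qed.

Lemma dual_le_norm f x : `|f x| <= dual_norm f * `|x|.
Proof. by move: x; apply/dual_norm_le => //; exact: dual_norm_ge0. Qed.

Let dual_normD f g : dual_norm (f + g) <= dual_norm f + dual_norm g.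
Proof.
apply/dual_norm_le => [|x]; first by rewrite addr_ge0 ?dual_norm_ge0.
by rewrite dualD (le_trans (ler_normD _ _))// mulrDl lerD ?dual_le_norm.
Qed.

Let dual_normZ_le a f : dual_norm (a *: f) <= `|a| * dual_norm f.
Proof.
apply/dual_norm_le => [|x]; first by rewrite mulr_ge0 ?dual_norm_ge0.
by rewrite dualZ normrM -mulrA ler_wpM2l ?dual_le_norm.
Qed.

Let dual_normZ a f : dual_norm (a *: f) = `|a| * dual_norm f.
Proof.
apply/eqP; rewrite eq_le dual_normZ_le/=.
have [->|a0] := eqVneq a 0; first by rewrite normr0 mul0r dual_norm_ge0.
rewrite -ler_pdivlMl ?normr_gt0// -normfV.
by rewrite -{1}(scale1r f) -(mulVf a0) -scalerA dual_normZ_le.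
Qed.

Let dual_norm0_eq0 f : dual_norm f = 0 -> f = 0.
Proof.
move=> f0; apply/val_inj/funext => x; apply/normr0_eq0/eqP.
by rewrite eq_le normr_ge0 (le_trans (dual_le_norm f x))// f0 mul0r.
Qed.

HB.instance Definition _ :=
  Lmodule_isNormed.Build R dual dual_normD dual_normZ dual_norm0_eq0.

End dual.

(* The order is kept separate from the [Order] hierarchy, whose structures
   cannot be joined with [NormedModule]: [Num.NumDomain] already inherits from
   both. *)
HB.mixin Record isNormedLattice (R : realType) X & NormedModule R X := {
  vle : X -> X -> Prop;
  vjoin : X -> X -> X;
  vmeet : X -> X -> X;
  vle_refl : forall x, vle x x;
  vle_anti : forall x y, vle x y -> vle y x -> x = y;
  vle_trans : forall y x z, vle x y -> vle y z -> vle x z;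
  vjoinP : forall x y z, vle (vjoin x y) z <-> vle x z /\ vle y z;
  vmeetP : forall x y z, vle z (vmeet x y) <-> vle z x /\ vle z y;
  vleD2r : forall x y z : X, vle x y -> vle (x + z) (y + z);
  vleZ_ge0 : forall (a : R) (x : X), 0 <= a -> vle 0 x -> vle 0 (a *: x);
  vle_norm : forall x y : X,
    vle (vjoin x (- x)) (vjoin y (- y)) -> `|x| <= `|y|
}.

#[short(type="normedLatticeType")]
HB.structure Definition NormedLattice (R : realType) :=
  {X of NormedModule R X & isNormedLattice R X}.

#[short(type="banachLatticeType")]
HB.structure Definition BanachLattice (R : realType) :=
  {X of NormedLattice R X & Complete X}.

Section lattice_notions.
Context {R : realType}.

Definition sublattice {X : normedLatticeType R} (A : set X) : Prop :=
  [/\ A 0,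
      forall a x y, A x -> A y -> A (a *: x + y),
      forall x y, A x -> A y -> A (vjoin x y) &
      forall x y, A x -> A y -> A (vmeet x y)].

Definition lattice_hom {X Y : normedLatticeType R} (f : {linear X -> Y}) : Prop :=
  {morph f : x y / vjoin x y} /\ {morph f : x y / vmeet x y}.

End lattice_notions.

Section Hspace.
Context {R : realType} (E : normedModType R).

Definition poshom (f : dual E -> R) : Prop :=
  forall (a : R) x, 0 <= a -> f (a *: x) = a * f x.

(* [sup_(|z| <= 1) \sum_k |x_k(z)| <= 1] *)
Definition weakly1 n (x : 'I_n -> dual E) : Prop :=
  forall z : E, `|z| <= 1 -> \sum_(k < n) `|x k z| <= 1.

Definition fbl_norm (f : dual E -> R) : \bar R :=
  ereal_sup [set s | exists n (x : 'I_n -> dual E),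
    weakly1 x /\ s = (\sum_(k < n) `|f (x k)|)%:E].

(* The functions of [H[E]] with finite norm. *)
Definition Hfin_pred : {pred dual E -> R} :=
  mem [set f : dual E -> R | poshom f /\ (fbl_norm f < +oo)%E].

Record Hfin := HFin {
  Hfin_fun :> dual E -> R; Hfin_funP : Hfin_fun \in Hfin_pred }.

HB.instance Definition _ := [isSub for Hfin_fun].
HB.instance Definition _ := [Choice of Hfin by <:].

Lemma fbl_norm_leP f (c : R) : (fbl_norm f <= c%:E)%E <->
  forall n (x : 'I_n -> dual E), weakly1 x -> \sum_(k < n) `|f (x k)| <= c.
Proof.
split=> [fc n x x1|fc].
  by rewrite -lee_fin (le_trans _ fc)//; apply: ereal_sup_ubound; exists n, x.
by apply: ge_ereal_sup => _ [n [x [x1 ->]]]; rewrite lee_fin fc.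
Qed.

Lemma fbl_norm_ge0 f : (0 <= fbl_norm f)%E.
Proof.
apply: ereal_sup_ubound; exists 0%N, (fun=> 0); rewrite big_ord0; split=> //.
by move=> z _; rewrite big_ord0.
Qed.

Lemma Hfin_predP f : f \in Hfin_pred <-> poshom f /\ exists c : R,
  forall n (x : 'I_n -> dual E), weakly1 x -> \sum_(k < n) `|f (x k)| <= c.
Proof.
rewrite inE; split=> -[fh] => [foo|[c fc]]; last first.
  by split=> //; apply: le_lt_trans (ltry c); apply/fbl_norm_leP.
split=> //; exists (fine (fbl_norm f)); apply/fbl_norm_leP.
by rewrite fineK// ge0_fin_numE// fbl_norm_ge0.
Qed.

Lemma Hfin_pred_sum2 (f g h : dual E -> R) (a b : R) : 0 <= a -> 0 <= b ->
  f \in Hfin_pred -> g \in Hfin_pred -> poshom h ->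
  (forall x, `|h x| <= a * `|f x| + b * `|g x|) -> h \in Hfin_pred.
Proof.
move=> a0 b0 /Hfin_predP[_ [c fc]] /Hfin_predP[_ [d gd]] hh hfg.
apply/Hfin_predP; split=> //; exists (a * c + b * d) => n x x1.
rewrite (le_trans (ler_sum _ (fun k _ => hfg (x k))))//.
by rewrite big_split/= -!mulr_sumr lerD// ler_wpM2l ?fc ?gd.
Qed.

Lemma Hfin_submod_closed : submod_closed Hfin_pred.
Proof.
split.
  apply/Hfin_predP; split=> [a x a0|]; first by rewrite /= mulr0.
  by exists 0 => n x _; rewrite big1// => k _; rewrite normr0.
move=> a f g fH gH.
have [fh _] := (Hfin_predP f).1 fH; have [gh _] := (Hfin_predP g).1 gH.
apply: (@Hfin_pred_sum2 f g _ `|a| 1) => //.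
  move=> b x b0; rewrite !fctE fh// gh// mulrDr; congr (_ + _).
  by rewrite /GRing.scale/= mulrCA.
by move=> x; rewrite mul1r -normrM ler_normD.
Qed.

HB.instance Definition _ :=
  GRing.isSubmodClosed.Build R (dual E -> R) Hfin_pred Hfin_submod_closed.
HB.instance Definition _ := [SubChoice_isSubLmodule of Hfin by <:].

Implicit Types f g h : Hfin.

Lemma HfinD f g x : (f + g) x = f x + g x. Proof. by []. Qed.

Lemma HfinZ a f x : (a *: f) x = a * f x. Proof. by []. Qed.

Lemma HfinN f x : (- f) x = - f x. Proof. by []. Qed.

Lemma HfinB f g x : (f - g) x = f x - g x. Proof. by []. Qed.

Lemma Hfin_poshom f : poshom f.
Proof. by have /Hfin_predP[] := Hfin_funP f. Qed.

Lemma Hfin_fun0 f : f 0 = 0.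
Proof. by have := @Hfin_poshom f 0 0 (lexx 0); rewrite scaler0 mul0r. Qed.

Definition Hfin_norm f : R := fine (fbl_norm f).

Lemma Hfin_normE f : (Hfin_norm f)%:E = fbl_norm f.
Proof.
rewrite fineK// ge0_fin_numE ?fbl_norm_ge0//.
by have := Hfin_funP f; rewrite inE => -[].
Qed.

Lemma Hfin_norm_leP f c : Hfin_norm f <= c <->
  forall n (x : 'I_n -> dual E), weakly1 x -> \sum_(k < n) `|f (x k)| <= c.
Proof. by rewrite -lee_fin Hfin_normE; exact: fbl_norm_leP. Qed.

Lemma Hfin_norm_ge0 f : 0 <= Hfin_norm f.
Proof. by rewrite -lee_fin Hfin_normE fbl_norm_ge0. Qed.

Lemma Hfin_le_norm f n (x : 'I_n -> dual E) : weakly1 x ->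
  \sum_(k < n) `|f (x k)| <= Hfin_norm f.
Proof. by move: n x; apply/Hfin_norm_leP. Qed.

Lemma Hfin_eval_le f x : `|f x| <= Hfin_norm f * `|x|.
Proof.
have [->|x0] := eqVneq x 0; first by rewrite Hfin_fun0 !normr0 mulr0.
have nx0 : 0 < `|x| by rewrite normr_gt0.
have : `|f (`|x|^-1 *: x)| <= Hfin_norm f.
  have := @Hfin_le_norm f 1 (fun=> `|x|^-1 *: x); rewrite !big_ord1; apply.
  move=> z z1; rewrite big_ord1 dualZ normrM ger0_norm ?invr_ge0//.
  rewrite ler_pdivrMl// mulr1 (le_trans (dual_le_norm x z))//.
  by rewrite -[leRHS]mulr1 ler_wpM2l ?dual_norm_ge0.
rewrite Hfin_poshom ?invr_ge0// normrM ger0_norm ?invr_ge0//.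
by rewrite ler_pdivrMl// mulrC.
Qed.

Lemma Hfin_norm_sum2 f g h (a b : R) : 0 <= a -> 0 <= b ->
  (forall x, `|h x| <= a * `|f x| + b * `|g x|) ->
  Hfin_norm h <= a * Hfin_norm f + b * Hfin_norm g.
Proof.
move=> a0 b0 hfg; apply/Hfin_norm_leP => n x x1.
rewrite (le_trans (ler_sum _ (fun k _ => hfg (x k))))//.
by rewrite big_split/= -!mulr_sumr lerD// ler_wpM2l// Hfin_le_norm.
Qed.

Let Hfin_normD f g : Hfin_norm (f + g) <= Hfin_norm f + Hfin_norm g.
Proof.
have := @Hfin_norm_sum2 f g (f + g) 1 1; rewrite !mul1r; apply=> // x.
by rewrite !mul1r ler_normD.
Qed.

Let Hfin_normZ_le a f : Hfin_norm (a *: f) <= `|a| * Hfin_norm f.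
Proof.
have := @Hfin_norm_sum2 f 0 (a *: f) `|a| 0; rewrite !mul0r addr0; apply=> // x.
by rewrite mul0r addr0 -normrM.
Qed.

Let Hfin_normZ a f : Hfin_norm (a *: f) = `|a| * Hfin_norm f.
Proof.
apply/eqP; rewrite eq_le Hfin_normZ_le/=.
have [->|a0] := eqVneq a 0; first by rewrite normr0 mul0r Hfin_norm_ge0.
rewrite -ler_pdivlMl ?normr_gt0// -normfV.
by rewrite -{1}(scale1r f) -(mulVf a0) -scalerA Hfin_normZ_le.
Qed.

Let Hfin_norm0_eq0 f : Hfin_norm f = 0 -> f = 0.
Proof.
move=> f0; apply/val_inj/funext => x; apply/normr0_eq0/eqP.
by rewrite eq_le normr_ge0 (le_trans (Hfin_eval_le f x))// f0 mul0r.
Qed.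

HB.instance Definition _ :=
  Lmodule_isNormed.Build R Hfin Hfin_normD Hfin_normZ Hfin_norm0_eq0.

Definition Hfin_le f g : Prop := forall x, f x <= g x.

Let Hfin_le_anti f g : Hfin_le f g -> Hfin_le g f -> f = g.
Proof.
by move=> fg gf; apply/val_inj/funext => x; apply/le_anti; rewrite fg gf.
Qed.

Let Hfin_le_trans g f h : Hfin_le f g -> Hfin_le g h -> Hfin_le f h.
Proof. by move=> fg gh x; exact: le_trans (gh x). Qed.

Lemma Hfin_max_subproof f g : (fun x => Num.max (f x) (g x)) \in Hfin_pred.
Proof.
apply: (@Hfin_pred_sum2 f g _ 1 1) => //; [exact: Hfin_funP..| |].
  by move=> a x a0; rewrite !Hfin_poshom// maxr_pMr.
move=> x; rewrite !mul1r; case: (leP (f x) (g x)) => _; first by rewrite lerDr.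
by rewrite lerDl.
Qed.

Definition Hfin_max f g : Hfin := HFin (Hfin_max_subproof f g).

Lemma Hfin_min_subproof f g : (fun x => Num.min (f x) (g x)) \in Hfin_pred.
Proof.
apply: (@Hfin_pred_sum2 f g _ 1 1) => //; [exact: Hfin_funP..| |].
  by move=> a x a0; rewrite !Hfin_poshom// minr_pMr.
move=> x; rewrite !mul1r; case: (leP (f x) (g x)) => _; first by rewrite lerDl.
by rewrite lerDr.
Qed.

Definition Hfin_min f g : Hfin := HFin (Hfin_min_subproof f g).

Let Hfin_maxP f g h :
  Hfin_le (Hfin_max f g) h <-> Hfin_le f h /\ Hfin_le g h.
Proof.
split=> [fgh|[fh gh] x]; last by rewrite /= ge_max fh gh.
by split=> x; have := fgh x; rewrite /= ge_max => /andP[].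
Qed.

Let Hfin_minP f g h :
  Hfin_le h (Hfin_min f g) <-> Hfin_le h f /\ Hfin_le h g.
Proof.
split=> [fgh|[fh gh] x]; last by rewrite /= le_min fh gh.
by split=> x; have := fgh x; rewrite /= le_min => /andP[].
Qed.

Let Hfin_leD2r f g h : Hfin_le f g -> Hfin_le (f + h) (g + h).
Proof. by move=> fg x; rewrite !HfinD lerD2r. Qed.

Let Hfin_leZ_ge0 (a : R) f : 0 <= a -> Hfin_le 0 f -> Hfin_le 0 (a *: f).
Proof. by move=> a0 f0 x; rewrite HfinZ mulr_ge0//; exact: f0. Qed.

Lemma Hfin_norm_mono f g : (forall x, `|f x| <= `|g x|) -> `|f| <= `|g|.
Proof.
move=> fg; have := @Hfin_norm_sum2 g 0 f 1 0.
by rewrite mul1r mul0r addr0; apply=> // x; rewrite mul1r mul0r addr0.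
Qed.

Let Hfin_le_norm_abs f g :
  Hfin_le (Hfin_max f (- f)) (Hfin_max g (- g)) -> `|f| <= `|g|.
Proof.
move=> fg; apply: Hfin_norm_mono => x.
by have := fg x; rewrite /= !maxrN.
Qed.

HB.instance Definition _ := isNormedLattice.Build R Hfin
  (fun _ _ => lexx _) Hfin_le_anti Hfin_le_trans Hfin_maxP Hfin_minP
  Hfin_leD2r Hfin_leZ_ge0 Hfin_le_norm_abs.

End Hspace.

Section Hfin_complete.
Context {R : realType} (E : normedModType R).

Lemma Hfin_complete (F : set_system (Hfin E)) :
  ProperFilter F -> cauchy F -> cvg F.
Proof.
move=> FF /cauchy_ballP Fc.
have Fx x : cvg ((fun f : Hfin E => f x) @ F).
  apply/cauchy_cvgP/cauchy_ballP => e e0; near_simpl.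
  have x0 : 0 < `|x| + 1 by rewrite ltr_wpDl.
  have d0 : 0 < e / (`|x| + 1) by rewrite divr_gt0.
  apply: filterS (Fc _ d0) => -[f g] /=; rewrite -!ball_normE/= => fg.
  rewrite -HfinB (le_lt_trans (Hfin_eval_le _ _))//.
  apply: (@le_lt_trans _ _ (`|f - g| * (`|x| + 1))).
    by rewrite ler_wpM2l ?Hfin_norm_ge0// lerDl.
  by rewrite -ltr_pdivlMr.
pose g x : R := lim ((fun f : Hfin E => f x) @ F).
have gh : poshom g.
  move=> a x a0; apply: cvg_lim => //.
  rewrite (_ : (fun f : Hfin E => f (a *: x)) = (fun f => a * f x)).
    by apply: cvgMl_tmp; exact: Fx.
  by apply/funext => f; rewrite Hfin_poshom.
have key (e : R) : 0 < e -> exists2 A, F A &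
    forall f, A f -> forall n (x : 'I_n -> dual E), weakly1 x ->
    \sum_(k < n) `|f (x k) - g (x k)| <= e.
  move=> e0; have [[A B] /= [FA FB] AB] := Fc _ e0.
  exists A => // f Af n x x1.
  have cv : (\sum_(k < n) `|f (x k) - h (x k)|) @[h --> F] -->
      \sum_(k < n) `|f (x k) - g (x k)|.
    apply: cvg_big => [|k _]; first exact: add_continuous.
    by apply: cvg_norm; apply: cvgB; [exact: cvg_cst|exact: Fx].
  refine (closed_cvg (fun r : R => r <= e) (@closed_le _ e) _ _ cv).
  apply: filterS FB => h Bh; have := AB (f, h) (conj Af Bh).
  rewrite /= -ball_normE/= => /ltW fh.
  rewrite (le_trans _ fh)//; exact: (Hfin_le_norm (f - h) x1).
have gH : g \in @Hfin_pred R E.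
  have [A FA Ag] := key _ ltr01.
  have [f Af] := filter_ex FA.
  apply/Hfin_predP; split => //; exists (`|f| + 1) => n x x1.
  rewrite (@le_trans _ _ (\sum_(k < n) (`|f (x k)| + `|f (x k) - g (x k)|)))//.
    by apply: ler_sum => k _; rewrite -lerBlDl distrC lerB_dist.
  by rewrite big_split/= lerD//; [exact: Hfin_le_norm|exact: Ag].
apply/cvg_ex; exists (HFin gH); apply/cvgrPdist_le => e e0.
have [A FA Ag] := key _ e0; apply: filterS FA => f Af.
by rewrite distrC; apply/Hfin_norm_leP => n x x1; exact: Ag.
Unshelve. all: by end_near. Qed.

HB.instance Definition _ := Uniform_isComplete.Build (Hfin E) Hfin_complete.

End Hfin_complete.

Section FBL.
Context {R : realType} (E : normedModType R).

Lemma delta_subproof (x : E) :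
  (fun xs : dual E => xs x) \in @Hfin_pred R E.
Proof.
apply/Hfin_predP; split=> //; exists `|x| => n xs xs1.
have [->|x0] := eqVneq x 0.
  by rewrite normr0 big1// => k _; rewrite raddf0 normr0.
have nx0 : 0 < `|x| by rewrite normr_gt0.
have := xs1 (`|x|^-1 *: x).
rewrite normrZ ger0_norm ?invr_ge0// mulVf ?gt_eqF// => /(_ (lexx _)).
under eq_bigr do rewrite linearZ/= normrM ger0_norm ?invr_ge0//.
by rewrite -mulr_sumr ler_pdivrMl// mulr1.
Qed.

Definition delta (x : E) : Hfin E := HFin (delta_subproof x).

Definition FBL_pred : {pred Hfin E} :=
  mem (closure (smallest sublattice (range delta))).

Record FBL := MkFBL { FBL_val :> Hfin E; FBL_valP : FBL_val \in FBL_pred }.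

HB.instance Definition _ := [isSub for FBL_val].
HB.instance Definition _ := [Choice of FBL by <:].

Lemma Hfin_closureP (A : set (Hfin E)) f :
  closure A f <-> forall e : R, 0 < e -> exists2 g, A g & `|f - g| < e.
Proof.
split=> [Af e e0|Af B].
  have [g [Ag]] := Af _ (nbhsx_ballx f e e0).
  by rewrite -ball_normE/=; exists g.
rewrite -nbhs_ballE => -[e e0 fB]; have [g Ag fg] := Af e e0.
by exists g; split=> //; apply: fB; rewrite -ball_normE.
Qed.

Lemma smallest_sublattice (A : set (Hfin E)) :
  sublattice (smallest sublattice A).
Proof.
split=> [B [[]]//|a f g Af Ag B BA|f g Af Ag B BA|f g Af Ag B BA];
  have [[B0 BL Bj Bm] _] := BA; [apply: BL|apply: Bj|apply: Bm];
  by [exact: Af|exact: Ag].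
Qed.

Lemma Hfin_lip (op : Hfin E -> Hfin E -> Hfin E) (a b : R) f g f' g' :
  0 <= a -> 0 <= b ->
  (forall x, `|op f g x - op f' g' x| <=
    a * `|f x - f' x| + b * `|g x - g' x|) ->
  `|op f g - op f' g'| <= a * `|f - f'| + b * `|g - g'|.
Proof. by move=> a0 b0 h; apply: Hfin_norm_sum2. Qed.

Lemma closure_lip (op : Hfin E -> Hfin E -> Hfin E) (a b : R)
    (A : set (Hfin E)) : 0 <= a -> 0 <= b ->
  (forall f g, A f -> A g -> A (op f g)) ->
  (forall f g f' g' x, `|op f g x - op f' g' x| <=
    a * `|f x - f' x| + b * `|g x - g' x|) ->
  forall f g, closure A f -> closure A g -> closure A (op f g).
Proof.
move=> a0 b0 Aop opab f g /Hfin_closureP Af /Hfin_closureP Ag.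
apply/Hfin_closureP => e e0.
have ab1 : 0 < a + b + 1 by rewrite ltr_wpDl// addr_ge0.
have d0 : 0 < e / (a + b + 1) by rewrite divr_gt0.
have [f' Af' ff'] := Af _ d0; have [g' Ag' gg'] := Ag _ d0.
exists (op f' g'); first exact: Aop.
rewrite (le_lt_trans (Hfin_lip a0 b0 (opab f g f' g')))//.
rewrite (@le_lt_trans _ _ ((a + b) * (e / (a + b + 1))))//.
  by rewrite mulrDl lerD// ler_wpM2l// ltW.
by rewrite mulrCA gtr_pMr// ltr_pdivrMr// mul1r ltrDl.
Qed.

Lemma closure_sublattice (A : set (Hfin E)) :
  sublattice A -> sublattice (closure A).
Proof.
move=> [A0 AL Aj Am]; split.
- exact: subset_closure.
- move=> a; apply: (@closure_lip (fun f g => a *: f + g) `|a| 1) => //.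
    by move=> f g; exact: AL.
  move=> f g f' g' x; rewrite !HfinD !HfinZ mul1r -normrM.
  by rewrite opprD addrACA -mulrBr ler_normD.
- apply: (@closure_lip (@vjoin R (Hfin E)) 1 1) => // f g f' g' x /=.
  rewrite !mul1r ler_norml; apply/andP; split.
    rewrite lerNl opprB lerBlDr ge_max; apply/andP; split.
      have := ler_norm (f' x - f x); rewrite distrC lerBlDr => /le_trans; apply.
      by rewrite lerD ?lerDl// le_max lexx.
    have := ler_norm (g' x - g x); rewrite distrC lerBlDr => /le_trans; apply.
    by rewrite lerD ?lerDr// le_max lexx orbT.
  rewrite lerBlDr ge_max; apply/andP; split.
    have := ler_norm (f x - f' x); rewrite lerBlDr => /le_trans; apply.
    by rewrite lerD ?lerDl// le_max lexx.
  have := ler_norm (g x - g' x); rewrite lerBlDr => /le_trans; apply.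
  by rewrite lerD ?lerDr// le_max lexx orbT.
- apply: (@closure_lip (@vmeet R (Hfin E)) 1 1) => // f g f' g' x /=.
  rewrite !mul1r ler_norml; apply/andP; split.
    rewrite lerNl opprB lerBlDl -lerBlDr le_min; apply/andP; split.
      rewrite lerBlDl; have := ler_norm (f' x - f x).
      rewrite distrC lerBlDr => ff'; rewrite (@le_trans _ _ (f' x))//.
        by rewrite ge_min lexx.
      by rewrite (le_trans ff')// lerD2r lerDl.
    rewrite lerBlDl; have := ler_norm (g' x - g x).
    rewrite distrC lerBlDr => gg'; rewrite (@le_trans _ _ (g' x))//.
      by rewrite ge_min lexx orbT.
    by rewrite (le_trans gg')// lerD2r lerDr.
  rewrite lerBlDl -lerBlDr le_min; apply/andP; split.
    rewrite lerBlDl; have := ler_norm (f x - f' x).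
    rewrite lerBlDr => ff'; rewrite (@le_trans _ _ (f x))//.
      by rewrite ge_min lexx.
    by rewrite (le_trans ff')// lerD2r lerDl.
  rewrite lerBlDl; have := ler_norm (g x - g' x).
  rewrite lerBlDr => gg'; rewrite (@le_trans _ _ (g x))//.
    by rewrite ge_min lexx orbT.
  by rewrite (le_trans gg')// lerD2r lerDr.
Qed.

Lemma FBL_sublattice : sublattice [set f | f \in FBL_pred].
Proof.
rewrite (_ : [set f | f \in FBL_pred] =
  closure (smallest sublattice (range delta))).
  exact/closure_sublattice/smallest_sublattice.
by apply/seteqP; split=> f /=; rewrite inE.
Qed.

Lemma FBL_submod_closed : submod_closed FBL_pred.
Proof. by have [F0 FL _ _] := FBL_sublattice; split. Qed.

HB.instance Definition _ :=
  GRing.isSubmodClosed.Build R (Hfin E) FBL_pred FBL_submod_closed.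
HB.instance Definition _ := [SubChoice_isSubLmodule of FBL by <:].

Implicit Types f g h : FBL.

Let FBL_norm f : R := `|FBL_val f|.

Let FBL_normD f g : FBL_norm (f + g) <= FBL_norm f + FBL_norm g.
Proof. exact: ler_normD. Qed.

Let FBL_normZ (a : R) f : FBL_norm (a *: f) = `|a| * FBL_norm f.
Proof. exact: normrZ. Qed.

Let FBL_norm0_eq0 f : FBL_norm f = 0 -> f = 0.
Proof. by move=> /normr0_eq0 f0; exact/val_inj. Qed.

HB.instance Definition _ :=
  Lmodule_isNormed.Build R FBL FBL_normD FBL_normZ FBL_norm0_eq0.

Lemma FBL_join_subproof f g : vjoin (FBL_val f) (FBL_val g) \in FBL_pred.
Proof. by have [_ _ Fj _] := FBL_sublattice; apply: Fj; exact: FBL_valP. Qed.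

Lemma FBL_meet_subproof f g : vmeet (FBL_val f) (FBL_val g) \in FBL_pred.
Proof. by have [_ _ _ Fm] := FBL_sublattice; apply: Fm; exact: FBL_valP. Qed.

Definition FBL_le f g : Prop := vle (FBL_val f) (FBL_val g).
Definition FBL_join f g : FBL := MkFBL (FBL_join_subproof f g).
Definition FBL_meet f g : FBL := MkFBL (FBL_meet_subproof f g).

Let FBL_le_anti f g : FBL_le f g -> FBL_le g f -> f = g.
Proof. by move=> fg gf; apply/val_inj; exact: vle_anti. Qed.

Let FBL_le_trans g f h : FBL_le f g -> FBL_le g h -> FBL_le f h.
Proof. exact: vle_trans. Qed.

Let FBL_joinP f g h :
  FBL_le (FBL_join f g) h <-> FBL_le f h /\ FBL_le g h.
Proof. exact: vjoinP. Qed.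

Let FBL_meetP f g h :
  FBL_le h (FBL_meet f g) <-> FBL_le h f /\ FBL_le h g.
Proof. exact: vmeetP. Qed.

Let FBL_leD2r f g h : FBL_le f g -> FBL_le (f + h) (g + h).
Proof. exact: vleD2r. Qed.

Let FBL_leZ_ge0 (a : R) f : 0 <= a -> FBL_le 0 f -> FBL_le 0 (a *: f).
Proof. exact: vleZ_ge0. Qed.

Let FBL_le_norm f g :
  FBL_le (FBL_join f (- f)) (FBL_join g (- g)) -> `|f| <= `|g|.
Proof. exact: vle_norm. Qed.

HB.instance Definition _ := isNormedLattice.Build R FBL
  (fun f => vle_refl (FBL_val f)) FBL_le_anti FBL_le_trans
  FBL_joinP FBL_meetP FBL_leD2r FBL_leZ_ge0 FBL_le_norm.

Let FBL_complete (F : set_system FBL) : ProperFilter F -> cauchy F -> cvg F.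
Proof.
move=> FF /cauchy_ballP Fc.
have /cauchy_cvgP/cvg_ex[/= h Fh] : cauchy (FBL_val @ F).
  apply/cauchy_ballP => e e0; near_simpl.
  apply: filterS (Fc _ e0) => -[f g] /=; rewrite -!ball_normE/=; exact.
have hF : h \in FBL_pred.
  rewrite inE; apply: (closed_cvg _ (@closed_closure _ _) _ _ Fh).
  by apply: filterE => f; have := FBL_valP f; rewrite inE.
apply/cvg_ex; exists (MkFBL hF); apply/cvgrPdist_lt => e e0.
exact: (@cvgr_dist_lt _ _ _ _ _ _ _ Fh).
Qed.

HB.instance Definition _ := Uniform_isComplete.Build FBL FBL_complete.

End FBL.
Arguments delta {R E} x.

Section l1.
Context (R : realType) (n : nat).

(* An alias, since ['rV[R]_n] itself carries the supremum norm. *)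
Definition l1 : Type := 'rV[R]_n.

HB.instance Definition _ := GRing.Lmodule.copy l1 'rV[R]_n.

Implicit Types x y z : l1.

Definition l1_norm x : R := \sum_(k < n) `|(x : 'rV[R]_n) 0 k|.

Let l1_normD x y : l1_norm (x + y) <= l1_norm x + l1_norm y.
Proof.
rewrite /l1_norm -big_split/=; apply: ler_sum => k _.
by rewrite mxE ler_normD.
Qed.

Let l1_normZ (a : R) x : l1_norm (a *: x) = `|a| * l1_norm x.
Proof.
by rewrite /l1_norm mulr_sumr; apply: eq_bigr => k _; rewrite mxE normrM.
Qed.

Let l1_norm0_eq0 x : l1_norm x = 0 -> x = 0.
Proof.
move=> /eqP; rewrite psumr_eq0// => /allP x0; apply/rowP => k.
by have := x0 k (mem_index_enum k); rewrite /= normr_eq0 mxE => /eqP.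
Qed.

HB.instance Definition _ :=
  Lmodule_isNormed.Build R l1 l1_normD l1_normZ l1_norm0_eq0.

Definition l1_le x y : Prop :=
  forall k, (x : 'rV[R]_n) 0 k <= (y : 'rV[R]_n) 0 k.

Definition l1_max x y : l1 :=
  \row_k Num.max ((x : 'rV[R]_n) 0 k) ((y : 'rV[R]_n) 0 k).

Definition l1_min x y : l1 :=
  \row_k Num.min ((x : 'rV[R]_n) 0 k) ((y : 'rV[R]_n) 0 k).

Let l1_le_anti x y : l1_le x y -> l1_le y x -> x = y.
Proof.
by move=> xy yx; apply/rowP => k; apply/le_anti; rewrite xy yx.
Qed.

Let l1_le_trans y x z : l1_le x y -> l1_le y z -> l1_le x z.
Proof. by move=> xy yz k; exact: le_trans (yz k). Qed.

Let l1_maxP x y z : l1_le (l1_max x y) z <-> l1_le x z /\ l1_le y z.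
Proof.
split=> [xyz|[xz yz] k]; last by rewrite mxE ge_max xz yz.
by split=> k; have := xyz k; rewrite mxE ge_max => /andP[].
Qed.

Let l1_minP x y z : l1_le z (l1_min x y) <-> l1_le z x /\ l1_le z y.
Proof.
split=> [xyz|[xz yz] k]; last by rewrite mxE le_min xz yz.
by split=> k; have := xyz k; rewrite mxE le_min => /andP[].
Qed.

Let l1_leD2r x y z : l1_le x y -> l1_le (x + z) (y + z).
Proof. by move=> xy k; rewrite !mxE lerD2r. Qed.

Let l1_leZ_ge0 (a : R) x : 0 <= a -> l1_le 0 x -> l1_le 0 (a *: x).
Proof.
by move=> a0 x0 k; have := x0 k; rewrite !mxE => ?; rewrite mulr_ge0.
Qed.

Let l1_le_norm x y : l1_le (l1_max x (- x)) (l1_max y (- y)) -> `|x| <= `|y|.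
Proof.
by move=> xy; apply: ler_sum => k _; have := xy k; rewrite !mxE !maxrN.
Qed.

HB.instance Definition _ := isNormedLattice.Build R l1
  (fun _ _ => lexx _) l1_le_anti l1_le_trans l1_maxP l1_minP
  l1_leD2r l1_leZ_ge0 l1_le_norm.

End l1.

Section notions.
Context {R : realType}.

Definition infinite_dimensional (E : lmodType R) : Prop :=
  forall n (b : 'I_n -> E), exists x : E,
    forall c : 'I_n -> R, x <> \sum_(k < n) c k *: b k.

(* [v] is the inverse of [u] on [range u]; its values elsewhere are irrelevant. *)
Definition l1_iso {X : normedModType R} n (u : {linear l1 R n -> X}) (K : R) :
    Prop :=
  exists2 v : X -> l1 R n, cancel u v &
    (opnorm setT u * opnorm (range u) v <= K%:E)%E.

Definition projection_onto {X : normedModType R} (P : {linear X -> X})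
    (A : set X) : Prop :=
  range P = A /\ forall x, P (P x) = P x.

Definition has_unif_compl_l1 (X : normedModType R) : Prop :=
  exists K : R, forall n,
    exists u : {linear l1 R n -> X}, exists P : {linear X -> X},
    [/\ l1_iso u K, projection_onto P (range u) & (opnorm setT P <= K%:E)%E].

(* The range of a linear lattice homomorphism is a sublattice. *)
Definition has_unif_l1_sublattices (X : banachLatticeType R) : Prop :=
  exists K : R, forall n, exists u : {linear l1 R n -> X},
    lattice_hom u /\ l1_iso u K.

Definition has_unif_lattice_compl_l1 (X : banachLatticeType R) : Prop :=
  exists K : R, forall n,
    exists u : {linear l1 R n -> X}, exists P : {linear X -> X},
    [/\ lattice_hom u, l1_iso u K, lattice_hom P,
        projection_onto P (range u) & (opnorm setT P <= K%:E)%E].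

(* The right-hand side is the average over all choices of signs. *)
Definition has_cotype (q : R) (X : normedModType R) : Prop :=
  exists C : R, forall n (x : 'I_n -> X),
    (\sum_(k < n) `|x k| `^ q) `^ q^-1 <=
    C * Num.sqrt ((2 ^+ n)^-1 *
      \sum_(eps : {ffun 'I_n -> bool})
        `|\sum_(k < n) (-1) ^+ (eps k) *: x k| ^+ 2).

Definition trivial_cotype (X : normedModType R) : Prop :=
  forall q : R, 2 <= q -> ~ has_cotype q X.

Definition lp_norm (p : \bar R) n (t : 'I_n -> R) : R :=
  match p with
  | r%:E => (\sum_(k < n) `|t k| `^ r) `^ r^-1
  | _ => \big[Num.max/0]_(k < n) `|t k|
  end.

Definition hom_continuous n (h : 'rV[R]_n -> R) : Prop :=
  continuous h /\ forall (a : R) t, 0 <= a -> h (a *: t) = a * h t.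

(* Krivine's functional calculus at [x]: a linear lattice homomorphism on the
   positively homogeneous continuous functions, sending the coordinates to the
   [x k]. In a Banach lattice it exists and its values on these functions are
   unique; its values elsewhere are irrelevant. *)
Definition krivine_calculus {X : banachLatticeType R} n (x : 'I_n -> X)
    (tau : ('rV[R]_n -> R) -> X) : Prop :=
  [/\ forall (a : R) f g, hom_continuous f -> hom_continuous g ->
        tau (fun t => a * f t + g t) = a *: tau f + tau g,
      forall f g, hom_continuous f -> hom_continuous g ->
        tau (fun t => Num.max (f t) (g t)) = vjoin (tau f) (tau g) &
      forall k, tau (fun t => t 0 k) = x k].

(* [(\sum_k |x k| ^ p) ^ (1 / p)] in [X] is given by the functional calculus. *)
Definition p_convex (p : \bar R) (X : banachLatticeType R) : Prop :=
  exists M : R, forall n (x : 'I_n -> X) (tau : ('rV[R]_n -> R) -> X),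
    krivine_calculus x tau ->
    `|tau (fun t => lp_norm p (fun k => t 0 k))| <=
      M * lp_norm p (fun k => `|x k|).

End notions.

(* Main.v *)
(* Everything reduces to one dichotomy for [dual E]: either it contains almost
   isometric copies of the unit vectors of [linf^n] (which, evaluated at norming
   points, give complemented copies of [l1^n] in [E] by diagonal dominance), or,
   by submultiplicativity over blocks of the constants comparing
   [\sum_i `|x i| ^+ 2] with the average over signs, an inequality of cotype
   type holds with a finite exponent.

   In the second case Pisier's factorization argument shows that a weakly
   1-summable sequence [x k] of functionals factors through a weighted [lp] with
   [p > 1], so that [FBL E] is [p]-convex. Moreover its dual does not contain
   [linf^n] uniformly: if [phi k] span such a copy and [f k] norm [phi k], then
   Riesz products in [f], formed by the functional calculus, give [g e] with
   [\sum_e e k * g e = 2 ^ n * f k] and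
   [`|g e| <= K * `|(\sum_k `|f k| ^ p) ^ (1 / p)|], whence
   [n <= C * n ^ (1 / p)], which fails for large [n].

   In the first case, the functions [(`|y j| - \sum_(i != j) `|y i|)^+] are
   disjoint, and they give lattice-complemented copies of [l1^n] in [FBL E]. *)
Require Import Defs.
From HB Require Import structures.
From mathcomp Require Import all_boot all_order all_algebra.
From mathcomp Require Import all_classical all_reals all_analysis.
From mathcomp Require Import ring lra complex.

Set Implicit Arguments.
Unset Strict Implicit.
Unset Printing Implicit Defensive.

Import Order.TTheory GRing.Theory Num.Theory.
Import numFieldNormedType.Exports.

Local Open Scope classical_set_scope.
Local Open Scope ring_scope.

(** * Averages over signs *)

(** Signs are averaged over squares because second moments make the block comparison exactly
    submultiplicative: multiplying the signs on a product set by independent signs of its rows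
    leaves the average unchanged. If some length N gains a factor b < 1 over the trivial bound,
    length N^m gains b^m; fewer than N^m vectors of a normalized family then exceed b^m, and any q
    with N b^q < 1 is a finite exponent. If no length gains, near-extremal families have norms close
    to 1 and sign sums of almost zero variance, so every single sign sum is close to 1.

    In the second case the extremal argument yields weights that control only subsets of the
    functionals, an estimate of weak type. Doubling the exponent from q+1 to 2(q+1) turns it into a
    strong one, since the dyadic series becomes summable. The exponent q+1 is kept even so that the
    power is convex on the whole line, without absolute values.

    The Riesz products have imaginary factors: their moduli depend only on the l2 norm, which is at
    most the lp norm because the conjugate exponent p is at most 2. All estimates in the free
    lattice are made at functionals, where evaluation is a real lattice homomorphism. *)

Section signs.
Variable I : finType.
Implicit Types d e : {ffun I -> bool}.

Definition flip d e : {ffun I -> bool} := [ffun i => d i (+) e i].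

Lemma flipK d : involutive (flip d).
Proof. by move=> e; apply/ffunP => i; rewrite !ffunE addKb. Qed.

Lemma sum_flip (V : nmodType) d (F : {ffun I -> bool} -> V) :
  \sum_e F (flip d e) = \sum_e F e.
Proof. by rewrite [RHS](reindex_inj (inv_inj (flipK d))). Qed.

End signs.

(** Restriction along [s] has fibres of constant size. Instead of counting them, the left sum is
    shown invariant under every flip [d]; summing over [d] first makes each term a full sum of
    [F]. *)
Lemma sum_restrict_signs (V : nmodType) (I J : finType) (s : J -> I)
    (F : {ffun J -> bool} -> V) : injective s ->
  (\sum_(e : {ffun I -> bool}) F [ffun j => e (s j)]) *+ 2 ^ #|J| =
  (\sum_e F e) *+ 2 ^ #|I|.
Proof.
move=> s_inj; pose lift_sign (d : {ffun J -> bool}) : {ffun I -> bool} :=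
  [ffun i => [exists j, (s j == i) && d j]].
have liftE d j : lift_sign d (s j) = d j.
  rewrite ffunE; apply/existsP/idP => [[k /andP[/eqP/s_inj ->]]//|dj].
  by exists j; rewrite eqxx.
have key d : \sum_(e : {ffun I -> bool}) F [ffun j => e (s j)] =
    \sum_(e : {ffun I -> bool}) F (flip d [ffun j => e (s j)]).
  rewrite -(sum_flip (lift_sign d)); apply: eq_bigr => e _; congr F.
  by apply/ffunP => j; rewrite !ffunE -[in RHS](liftE d) ffunE.
rewrite -[2%N in LHS]card_bool -card_ffun -sumr_const.
rewrite (eq_bigr _ (fun d _ => key d)) exchange_big/=.
rewrite -[2%N in RHS]card_bool -card_ffun -sumr_const; apply: eq_bigr => e _.
under eq_bigr => d _.
  rewrite (_ : flip d _ = flip [ffun j => e (s j)] d); last first.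
    by apply/ffunP => j; rewrite !ffunE addbC.
  over.
exact: sum_flip.
Qed.

Lemma half_double (R : numFieldType) (a : R) : 2^-1 * (a + a) = a.
Proof. by rewrite -mulr2n -[a *+ 2]mulr_natl mulKf ?pnatr_eq0. Qed.

Section rademacher.
Context {R : realType} {X : normedModType R}.
Implicit Type I J : finType.

Definition signsum I (x : I -> X) (e : {ffun I -> bool}) : X :=
  \sum_i (-1) ^+ (e i) *: x i.

Definition rad I (x : I -> X) : R :=
  (2 ^+ #|I|)^-1 * \sum_e `|signsum x e| ^+ 2.

Lemma rad_ge0 I (x : I -> X) : 0 <= rad x.
Proof. by rewrite mulr_ge0 ?invr_ge0 ?exprn_ge0 ?sumr_ge0. Qed.

Lemma signsumZ I (a : R) (x : I -> X) e :
  signsum (fun i => a *: x i) e = a *: signsum x e.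
Proof.
by rewrite scaler_sumr; apply: eq_bigr => i _; rewrite !scalerA mulrC.
Qed.

Lemma radZ I (a : R) (x : I -> X) : rad (fun i => a *: x i) = a ^+ 2 * rad x.
Proof.
rewrite /rad mulrCA; congr (_ * _); rewrite mulr_sumr; apply: eq_bigr => e _.
by rewrite signsumZ normrZ exprMn real_normK// num_real.
Qed.

Lemma signsum_mask I (x : I -> X) (A : pred I) e :
  signsum (fun i => if A i then x i else 0) e =
  2^-1 *: (signsum x e + signsum x (flip [ffun i => ~~ A i] e)).
Proof.
rewrite /signsum -big_split/= scaler_sumr; apply: eq_bigr => i _.
rewrite !ffunE; case: (A i) => /=; last first.
  by rewrite signrN scaleNr subrr !scaler0.
by rewrite -scalerDl scalerA; congr (_ *: _); lra.
Qed.

Lemma norm_le_signsum I (x : I -> X) i :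
  2 ^+ #|I| * `|x i| <= \sum_e `|signsum x e|.
Proof.
have xi e : `|x i| <= 2^-1 * (`|signsum x e| +
    `|signsum x (flip [ffun k => k != i] e)|).
  have -> : `|x i| = `|signsum (fun k => if pred1 i k then x k else 0) e|.
    rewrite /signsum (bigD1 i)//= eqxx big1 ?addr0.
      by rewrite normrZ normrX normrN normr1 expr1n mul1r.
    by move=> k /negbTE ->; rewrite scaler0.
  rewrite signsum_mask normrZ ger0_norm// ler_wpM2l//.
  exact: ler_normD.
have := ler_sum (index_enum _) (fun e (_ : true) => xi e).
rewrite -mulr_sumr big_split/= (sum_flip _ (fun e => `|signsum x e|)).
rewrite sumr_const card_ffun card_bool -[_ *+ 2 ^ _]mulr_natl natrX.
move=> /le_trans; apply.
by rewrite half_double.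
Qed.

(** Masking averages out the signs off [A], a conditional expectation, which is contractive by
    convexity of the square. *)
Lemma rad_mask I (x : I -> X) (A : pred I) :
  rad (fun i => if A i then x i else 0) <= rad x.
Proof.
rewrite ler_wpM2l ?invr_ge0 ?exprn_ge0//.
apply: (@le_trans _ _ (\sum_e 2^-1 * (`|signsum x e| ^+ 2 +
    `|signsum x (flip [ffun i => ~~ A i] e)| ^+ 2))).
  apply: ler_sum => e _; rewrite signsum_mask normrZ ger0_norm//.
  set u := signsum x e; set v := signsum x _.
  apply: (@le_trans _ _ ((2^-1 * (`|u| + `|v|)) ^+ 2)).
    by rewrite ler_pXn2r ?nnegrE ?mulr_ge0 ?addr_ge0// ler_wpM2l// ler_normD.
  rewrite -subr_ge0 (_ : _ - _ = (2^-1 * (`|u| - `|v|)) ^+ 2) ?sqr_ge0//.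
  by field.
rewrite -mulr_sumr big_split/= (sum_flip _ (fun e => `|signsum x e| ^+ 2)).
by rewrite half_double.
Qed.

Lemma rad_restrict I J (x : I -> X) (s : J -> I) : injective s ->
  rad (x \o s) = (2 ^+ #|I|)^-1 *
    \sum_(e : {ffun I -> bool}) `|signsum (x \o s) [ffun j => e (s j)]| ^+ 2.
Proof.
move=> s_inj; have := sum_restrict_signs
  (fun e => `|signsum (x \o s) e| ^+ 2) s_inj.
rewrite -[LHS]mulr_natl -[RHS]mulr_natl !natrX /rad => E.
have nz k : (2 : R) ^+ k != 0 by rewrite expf_neq0.
apply: (mulfI (nz #|I|)); rewrite mulVKf//.
by rewrite mulrCA -E mulKf.
Qed.

Lemma rad_inj I J (x : I -> X) (s : J -> I) : injective s ->
  rad (x \o s) <= rad x.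
Proof.
move=> s_inj; apply: le_trans (rad_mask x (mem (s @: J)%SET)).
rewrite le_eqVlt (rad_restrict x s_inj); apply/orP; left; apply/eqP.
congr (_ * _); apply: eq_bigr => e _; congr (`|_| ^+ 2); rewrite /signsum.
transitivity (\sum_(i in (s @: J)%SET) (-1) ^+ e i *: x i).
  by rewrite big_imset/=; [apply: eq_bigr => j _; rewrite ffunE|exact: in2W].
rewrite big_mkcond; apply: eq_bigr => i _ /=.
by case: ifP => // _; rewrite scaler0.
Qed.

Lemma norm_sqr_le_rad I (x : I -> X) i : `|x i| ^+ 2 <= rad x.
Proof.
have cst_inj : injective ((fun=> i) : unit -> I) by case=> -[].
apply: le_trans (rad_inj x cst_inj).
rewrite /rad card_unit (eq_bigr (fun=> `|x i| ^+ 2)).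
  by rewrite sumr_const card_ffun card_bool card_unit -[_ *+ 2 ^ _]mulr_natl
    mulKf.
move=> e _; rewrite /signsum (big_pred1 tt)/=; last by case.
by rewrite normrZ normrX normrN normr1 expr1n mul1r.
Qed.

(** The second inequality is applied in every row, with the signs of the row restricted from one [e]
    on [I * J]; for fixed [e] the first is applied to the signed row sums [y i e]. The extra row
    signs [t] are absorbed into [e] by [sum_flip]. *)
Lemma rad_block I J (x : I * J -> X) (b c : R) : 0 <= b -> 0 <= c ->
  (forall y : I -> X, \sum_i `|y i| ^+ 2 <= b * rad y) ->
  (forall y : J -> X, \sum_j `|y j| ^+ 2 <= c * rad y) ->
  \sum_p `|x p| ^+ 2 <= b * c * rad x.
Proof.
move=> b0 c0 hI hJ.
pose y i (e : {ffun I * J -> bool}) :=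
  signsum (x \o pair i) [ffun j => e (i, j)].
have pair_injr (i : I) : injective (@pair I J i) by move=> j k [].
apply: (@le_trans _ _ (\sum_i c * rad (x \o pair i))).
  rewrite (eq_bigr (fun p => `|x (p.1, p.2)| ^+ 2)); last by case.
  rewrite -(pair_bigA _ (fun i j => `|x (i, j)| ^+ 2))/=.
  by apply: ler_sum => i _; exact: hJ.
rewrite -mulr_sumr [b * c]mulrC -mulrA ler_wpM2l//.
under eq_bigr do rewrite (rad_restrict x (pair_injr _)).
rewrite -mulr_sumr exchange_big/= mulrCA ler_wpM2l ?invr_ge0 ?exprn_ge0//.
have yE (t : {ffun I -> bool}) e : signsum (y ^~ e) t =
    signsum x (flip [ffun p => t p.1] e).
  rewrite /signsum [RHS](eq_bigr (fun p => (-1) ^+ (t p.1 (+) e (p.1, p.2)) *: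
    x (p.1, p.2))); last by case=> i j _; rewrite !ffunE.
  rewrite -(pair_bigA _ (fun i j => (-1) ^+ (t i (+) e (i, j)) *: x (i, j)))/=.
  apply: eq_bigr => i _; rewrite scaler_sumr; apply: eq_bigr => j _.
  by rewrite ffunE scalerA -signr_addb.
apply: (@le_trans _ _ (\sum_e b * rad (y ^~ e))).
  by apply: ler_sum => e _; exact: hI.
rewrite -mulr_sumr ler_wpM2l//.
rewrite -mulr_sumr exchange_big/=.
rewrite (eq_bigr (fun=> \sum_e `|signsum x e| ^+ 2)); last first.
  move=> t _; rewrite -[RHS](sum_flip [ffun p => t p.1]).
  by apply: eq_bigr => e _; rewrite yE.
rewrite sumr_const card_ffun card_bool.
by rewrite -[_ *+ 2 ^ _]mulr_natl natrX mulrA mulVf ?mul1r// expf_neq0.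
Qed.

End rademacher.

(** Iterated pairs rather than functions, so that the successor case is a product as in
    [rad_block]. *)
Fixpoint powT (T : finType) m : finType :=
  if m is m'.+1 then (T * powT T m')%type else unit.

Lemma card_powT (T : finType) m : #|powT T m| = (#|T| ^ m)%N.
Proof. by elim: m => [|m IHm]; rewrite ?card_unit// card_prod IHm expnS. Qed.

Section real_sums.
Variable R : realType.

Lemma sum_geometric_half_le M : \sum_(m < M) (2^-1 : R) ^+ m <= 2.
Proof.
suff -> : \sum_(m < M) (2^-1 : R) ^+ m = 2 - 2 * 2^-1 ^+ M.
  by rewrite lerBlDr lerDl mulr_ge0 ?exprn_ge0.
elim: M => [|M IHM]; first by rewrite big_ord0 expr0 mulr1 subrr.
by rewrite big_ord_recr/= IHM exprS; field.
Qed.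

(** A layer-cake bound along the levels [b ^+ m]: when [a] is above level [M.+1], the new layer pays
    exactly for the remainder [(b ^+ q) ^+ M] of the previous step. *)
Lemma expr_layer_le (a b : R) q M : 0 <= a <= 1 -> 0 <= b ->
  a ^+ q <= (b ^+ q) ^+ M + \sum_(m < M) (b ^+ q) ^+ m * (b ^+ m.+1 < a)%R%:R.
Proof.
move=> /andP[a0 a1] b0; elim: M => [|M IHM].
  by rewrite big_ord0 addr0 expr0 exprn_ile1.
have [ab|ba] := leP a (b ^+ M.+1).
  rewrite (@le_trans _ _ ((b ^+ q) ^+ M.+1))//.
    by rewrite -exprM mulnC exprM lerXn2r ?nnegrE ?exprn_ge0.
  by rewrite lerDl sumr_ge0// => m _; rewrite mulr_ge0 ?exprn_ge0.
rewrite big_ord_recr/= ba mulr1 (le_trans IHM)//.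
have : 0 <= (b ^+ q) ^+ M.+1 by rewrite !exprn_ge0.
lra.
Qed.

Lemma exists_expr_le (b e : R) : 0 <= b < 1 -> 0 < e ->
  exists2 k, (0 < k)%N & b ^+ k <= e.
Proof.
move=> /andP[b0 b1] e0.
have : b ^+ k @[k --> \oo] --> (0 : R) by apply: cvg_expr; rewrite ger0_norm.
move=> /cvgr0Pnorm_le/(_ _ e0)[k _ kP]; exists k.+1 => //.
by have := kP k.+1; rewrite /= ger0_norm ?exprn_ge0//; apply.
Qed.

Lemma exists_truncn_gt (a : R) : exists n : nat, a < n%:R.
Proof. by exists (Num.truncn a).+1; exact: truncnS_gt. Qed.

End real_sums.

(** * The dichotomy between almost flat families and power summability *)

Section flat_or_cotype.
Context {R : realType} {X : normedModType R}.

Definition power_summing (q : nat) (C : R) : Prop :=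
  forall (I : finType) (x : I -> X), rad x <= 1 -> \sum_i `|x i| ^+ q <= C.

Lemma rad_pow (T : finType) (b : R) m : 0 <= b ->
  (forall y : T -> X, \sum_i `|y i| ^+ 2 <= b * rad y) ->
  forall y : powT T m -> X, \sum_i `|y i| ^+ 2 <= b ^+ m * rad y.
Proof.
move=> b0 hb; elim: m => [|m IHm] y; last first.
  by rewrite exprS; apply: rad_block => //; rewrite exprn_ge0.
rewrite (big_pred1 tt); last by case.
by rewrite expr0 mul1r norm_sqr_le_rad.
Qed.

(** Otherwise [N ^ m] of these vectors, indexed by [powT 'I_N m], would have squares summing to more
    than [(N b^2)^m], which is the bound of [rad_pow] when [rad] is at most 1. *)
Lemma card_large_lt N (b : R) m (I : finType) (x : I -> X) :
  (0 < N)%N -> 0 <= b ->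
  (forall y : 'I_N -> X, \sum_i `|y i| ^+ 2 <= N%:R * b ^+ 2 * rad y) ->
  rad x <= 1 -> (#|[pred i | (b ^+ m < `|x i|)%R]| < N ^ m)%N.
Proof.
move=> N0 b0 hb x1; rewrite ltnNge; apply/negP => leA.
set A := [pred i | _] in leA.
have leT : (#|powT 'I_N m| <= #|A|)%N by rewrite card_powT card_ord.
pose s (j : powT 'I_N m) : I := enum_val (widen_ord leT (enum_rank j)).
have s_inj : injective s.
  move=> j k /enum_val_inj/(congr1 val)/= jk.
  by apply/enum_rank_inj/val_inj.
have sA j : b ^+ m < `|x (s j)| by have
  := enum_valP (widen_ord leT (enum_rank j)).
have Nb0 : 0 <= N%:R * b ^+ 2 by rewrite mulr_ge0 ?exprn_ge0.
have := rad_pow (m := m) Nb0 hb (x \o s).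
apply/negP; rewrite -ltNge.
apply: (@le_lt_trans _ _ ((N%:R * b ^+ 2) ^+ m)).
  by rewrite ler_piMr ?exprn_ge0// (le_trans (rad_inj x s_inj)).
have -> : (N%:R * b ^+ 2) ^+ m = \sum_(j : powT 'I_N m) (b ^+ m) ^+ 2.
  by rewrite sumr_const card_powT card_ord exprMn -natrX mulr_natl -!exprM
    mulnC.
have /card_gt0P[j _] : (0 < #|powT 'I_N m|)%N.
  by rewrite card_powT card_ord expn_gt0 N0.
apply: ltr_sum; first by apply/hasP; exists j => //; rewrite mem_index_enum.
by move=> i _; apply: ltr_wpXn2r; rewrite ?nnegrE ?exprn_ge0//; exact: sA.
Qed.

Lemma power_summing_of_rad_gap N (b : R) : (0 < N)%N -> 0 <= b < 1 ->
  (forall y : 'I_N -> X, \sum_i `|y i| ^+ 2 <= N%:R * b ^+ 2 * rad y) ->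
  exists q (C : R), [/\ (1 < q)%N, ~~ odd q, 0 <= C & power_summing q C].
Proof.
move=> N0 /andP[b0 b1] hb.
have e0 : 0 < (2 * N%:R)^-1 :> R by rewrite invr_gt0 mulr_gt0 ?ltr0n.
have [k k0 bk] := @exists_expr_le R b _ (introT andP (conj b0 b1)) e0.
have bq : b ^+ k.*2 <= (2 * N%:R)^-1.
  rewrite -addnn exprD (le_trans _ bk)// ler_piMr ?exprn_ge0//.
  by rewrite exprn_ile1// ltW.
have Nbq : N%:R * b ^+ k.*2 <= 2^-1.
  rewrite (le_trans (ler_wpM2l _ bq))// invfM mulrCA mulfV ?mulr1//.
  by rewrite pnatr_eq0 -lt0n.
(* Since [N b^q <= 1/2], the layer [m] contributes at most [b^(q m) N^(m+1) <= N / 2^m]; these add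
   up to [2 N], and the remainder costs 1. *)
exists k.*2, (2 * N%:R + 1); split=> //; rewrite ?odd_double//.
- by rewrite -(doubleS 0) leq_double.
move=> I x x1; set q := k.*2.
have xi1 i : 0 <= `|x i| <= 1.
  by rewrite normr_ge0/= -(@expr_le1 _ 2)// (le_trans (norm_sqr_le_rad x i)).
(* With as many layers as indices, the remainders total at most [#|I| / 2^#|I| <= 1]. *)
pose M := #|I|.
apply: le_trans (ler_sum _ (fun i _ => expr_layer_le q M (xi1 i) b0)) _.
rewrite big_split/= addrC; apply: lerD; last first.
  rewrite sumr_const -mulr_natr.
  have b2 : b ^+ q <= 2^-1.
    apply: le_trans Nbq; rewrite ler_peMl ?exprn_ge0//.
    by rewrite ler1n.
  apply: (@le_trans _ _ (2^-1 ^+ M * #|I|%:R)).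
    by rewrite ler_wpM2r// lerXn2r ?nnegrE ?exprn_ge0.
  rewrite exprVn mulrC ler_pdivrMr ?exprn_gt0// mul1r -natrX ler_nat.
  by rewrite ltnW// ltn_expl.
rewrite exchange_big/=.
apply: (@le_trans _ _ (\sum_(m < M) N%:R * 2^-1 ^+ m)); last first.
  by rewrite -mulr_sumr mulrC ler_wpM2r// sum_geometric_half_le.
apply: ler_sum => m _; rewrite -mulr_sumr.
have -> : \sum_i (b ^+ m.+1 < `|x i|)%R%:R = #|[pred i | b ^+ m.+1 < `|x
  i|]|%:R :> R.
  rewrite -sum1_card natr_sum [RHS]big_mkcond/=; apply: eq_bigr => i _.
  by rewrite inE/=; case: (_ < _).
apply: (@le_trans _ _ ((b ^+ q) ^+ m * N%:R ^+ m.+1)).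
  rewrite ler_wpM2l ?exprn_ge0// -natrX ler_nat ltnW//.
  exact: card_large_lt.
rewrite exprS mulrCA -exprMn ler_wpM2l// lerXn2r ?nnegrE//.
  by rewrite mulr_ge0 ?exprn_ge0.
by rewrite mulrC.
Qed.

(** The norms of the sign sums have mean square 1 and, by [norm_le_signsum], mean at least [1 - t].
    So the sum of their squared deviations from 1, over all signs, is at most [2 ^+ N.+1 * t], and
    so is each single one. *)
Lemma flat_of_rad_extremal N (x : 'I_N -> X) (d t : R) :
  0 <= t -> t <= d -> d < 1 -> 2 ^+ N.+1 * t <= d ^+ 2 -> rad x = 1 ->
  (forall i, 1 - t <= `|x i| ^+ 2) -> forall e, `|signsum x e| <= 1 + d.
Proof.
move=> t0 td d1 tN x1 xt e.
have d0 : 0 <= d by exact: le_trans td.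
case: N x tN x1 xt e => [x _ _ _ e|N x tN x1 xt e].
  by rewrite /signsum big_ord0 normr0 addr_ge0.
pose F (e : {ffun 'I_N.+1 -> bool}) := `|signsum x e|.
have F2 : \sum_e F e ^+ 2 = 2 ^+ N.+1.
  move: x1; rewrite /rad card_ord => /(congr1 ( *%R (2 ^+ N.+1))).
  by rewrite mulVKf ?mulr1// expf_neq0.
have F1 : 2 ^+ N.+1 * (1 - t) <= \sum_e F e.
  apply: le_trans (norm_le_signsum x ord0); rewrite card_ord ler_wpM2l//.
  rewrite (le_trans (xt ord0))// expr2 ler_piMr//.
  by rewrite -(@expr_le1 _ 2)// (le_trans (norm_sqr_le_rad x _))// x1.
have FV : \sum_e (F e - 1) ^+ 2 <= d ^+ 2.
  apply: le_trans tN.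
  under eq_bigr do rewrite sqrrB1.
  rewrite big_split/= sumrB F2 sumrMnl sumr_const card_ffun card_bool card_ord.
  rewrite -[_ *+ 2 ^ _]mulr_natl natrX mulr1.
  move: F1; rewrite [2 ^+ N.+2]exprS mulrBr mulr1; lra.
have : (F e - 1) ^+ 2 <= d ^+ 2.
  apply: le_trans FV; rewrite (bigD1 e)//= lerDl sumr_ge0// => f _.
  exact: sqr_ge0.
rewrite -ler_sqrt ?exprn_ge0//
  !sqrtr_sqr (ger0_norm d0) => /(le_trans (ler_norm _)).
by rewrite lerBlDl.
Qed.

Definition almost_flat : Prop := forall N (d : R), 0 < d < 1 ->
  exists x : 'I_N -> X, (forall i, 1 - d <= `|x i|) /\
    forall e, `|signsum x e| <= 1 + d.

Lemma almost_flat_or_power_summing : almost_flat \/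
  exists q (C : R), [/\ (1 < q)%N, ~~ odd q, 0 <= C & power_summing q C].
Proof.
have [[N [b [N0 b1 hb]]]|no_gap] := pselect (exists N (b : R),
    [/\ (0 < N)%N, 0 <= b < 1 &
    forall y : 'I_N -> X, \sum_i `|y i| ^+ 2 <= N%:R * b ^+ 2 * rad y]).
  by right; exact: power_summing_of_rad_gap hb.
left=> N d /andP[d0 d1].
case: N => [|N].
  exists (fun=> 0); split=> [[]//|e].
  by rewrite /signsum big_ord0 normr0 addr_ge0// ltW.
set n := N.+1.
(* The value giving equality in the smallness hypothesis of [flat_of_rad_extremal]. *)
pose t : R := d ^+ 2 / 2 ^+ n.+1.
have p2 : 0 < 2 ^+ n.+1 :> R by rewrite exprn_gt0.
have t0 : 0 < t by rewrite divr_gt0// exprn_gt0.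
have d2 : d ^+ 2 <= d by rewrite expr2 ler_piMr// ltW.
have td : t <= d.
  rewrite ler_pdivrMr// (le_trans d2)// ler_peMr ?exprn_ege1 ?ler1n//.
  exact: ltW.
have n0 : 0 < n%:R :> R by rewrite ltr0n.
have n1 : 1 <= n%:R :> R by rewrite ler1n.
(* Chosen so that [n (1 - h)^2 >= n - t]. As the other [n - 1] squares are at most 1 each, every
   square is then at least [1 - t]. *)
pose h : R := t / (2 * n%:R).
have h0 : 0 < h by rewrite divr_gt0// mulr_gt0.
have h1 : h < 1.
  by rewrite ltr_pdivrMr ?mulr_gt0// mul1r; lra.
have [y hy] : exists y : 'I_n -> X,
    n%:R * (1 - h) ^+ 2 * rad y < \sum_i `|y i| ^+ 2.
  apply: contrapT => /forallNP hy; apply: no_gap; exists n, (1 - h); split=> //.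
    by apply/andP; split; lra.
  by move=> y; rewrite leNgt; apply/negP; exact: hy.
have y0 : 0 < rad y.
  rewrite lt_neqAle rad_ge0 andbT eq_sym; apply/eqP => y0.
  move: hy; rewrite y0 mulr0 ltNge => /negP; apply.
  rewrite sumr_le0// => i _; rewrite -y0; exact: norm_sqr_le_rad.
pose r := Num.sqrt (rad y).
have r0 : 0 < r by rewrite sqrtr_gt0.
have r2 : r ^+ 2 = rad y by rewrite sqr_sqrtr// ltW.
pose x i := r^-1 *: y i.
have x1 : rad x = 1 by rewrite radZ exprVn r2 mulVf// gt_eqF.
have hx : n%:R * (1 - h) ^+ 2 < \sum_i `|x i| ^+ 2.
  under eq_bigr do rewrite normrZ exprMn normfV (gtr0_norm r0).
  by rewrite -mulr_sumr exprVn ltr_pdivlMl ?exprn_gt0// r2 mulrC.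
have xt i : 1 - t <= `|x i| ^+ 2.
  have : \sum_(k | k != i) `|x k| ^+ 2 <= N%:R.
    apply: (@le_trans _ _ (\sum_(k < n | k != i) 1)).
      by apply: ler_sum => k _; rewrite (le_trans (norm_sqr_le_rad x k))// x1.
    rewrite sumr_const ler_nat cardC1 card_ord.
    by [].
  move: hx; rewrite (bigD1 i)//=.
  have : 2 * (n%:R * h) = t by rewrite /h; field; rewrite gt_eqF// ltW.
  have : n%:R = N%:R + 1 :> R by rewrite /n -natr1.
  have : 0 <= n%:R * h ^+ 2 by rewrite mulr_ge0 ?exprn_ge0// ltW.
  have -> : n%:R * (1 - h) ^+ 2 = n%:R - 2 * (n%:R * h) + n%:R * h ^+ 2 by ring.
  lra.
exists x; split=> [i|].
  rewrite (@le_trans _ _ (1 - t))//; first by rewrite lerD2l lerN2.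
  rewrite (le_trans (xt i))// expr2 ler_piMr//.
  by rewrite -(@expr_le1 _ 2)// (le_trans (norm_sqr_le_rad x i))// x1.
apply: (@flat_of_rad_extremal n x d t) => //; first exact: ltW.
by rewrite /t mulrC divfK// gt_eqF.
Qed.

Lemma power_summing_has_cotype q (C : R) : (0 < q)%N ->
  power_summing q C -> has_cotype q%:R X.
Proof.
move=> q0 hC.
have C0 : 0 <= C.
  have := hC void (fun=> 0); rewrite big1 => [|[]//]; apply.
  rewrite /rad big1 ?mulr0// => e _.
  by rewrite /signsum big1 ?normr0 ?expr0n// => -[].
exists (C `^ q%:R^-1) => n x.
have -> : (2 ^+ n)^-1 * \sum_(eps : {ffun 'I_n -> bool})
    `|\sum_(k < n) (-1) ^+ eps k *: x k| ^+ 2 = rad x.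
  by rewrite /rad card_ord.
under eq_bigr do rewrite powR_mulrn//.
set r := Num.sqrt (rad x).
have qn0 : (q%:R : R) != 0 by rewrite pnatr_eq0 -lt0n.
have r0 : 0 <= r by exact: sqrtr_ge0.
have r2 : r ^+ 2 = rad x by rewrite sqr_sqrtr// rad_ge0.
have -> : r = (r ^+ q) `^ q%:R^-1.
  by rewrite -powR_mulrn// -powRrM mulfV// powRr1.
rewrite -powRM ?exprn_ge0//.
apply: ge0_ler_powR; rewrite ?nnegrE ?invr_ge0 ?mulr_ge0 ?exprn_ge0//.
  by rewrite sumr_ge0// => k _; rewrite exprn_ge0.
move: r0; rewrite le_eqVlt => /predU1P[r0|r0].
  rewrite -r0 expr0n gtn_eqF// mulr0 sumr_le0// => k _.
  have := norm_sqr_le_rad x k.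
  rewrite -r2 -r0 expr0n/= => xk; have /eqP : `|x k| ^+ 2 = 0.
    by apply/le_anti; rewrite xk exprn_ge0.
  by rewrite sqrf_eq0 => /eqP ->; rewrite expr0n gtn_eqF.
have key k : `|r^-1 *: x k| ^+ q = (r ^+ q)^-1 * `|x k| ^+ q.
  by rewrite normrZ normfV (gtr0_norm r0) exprMn exprVn.
have : \sum_k `|r^-1 *: x k| ^+ q <= C.
  apply: (hC _ (fun k => r^-1 *: x k)).
  by rewrite radZ exprVn r2 mulVf// -r2 gt_eqF// exprn_gt0.
rewrite (eq_bigr _ (fun k _ => key k)) -mulr_sumr.
by rewrite ler_pdivrMl ?exprn_gt0// mulrC.
Qed.

End flat_or_cotype.

(** * Functionals and copies of l1 *)

Definition linear_of (R : realType) (U V : lmodType R) (f : U -> V)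
    (hf : linear f) : {linear U -> V} :=
  HB.pack f (GRing.isLinear.Build R U V *:%R f hf).

Section dual_facts.
Context {R : realType} {X : normedModType R}.
Implicit Types f : dual X.

Lemma dual_sumE I (r : seq I) (P : pred I) (f : I -> dual X) z :
  (\sum_(i <- r | P i) f i) z = \sum_(i <- r | P i) f i z.
Proof. by apply: (big_morph (fun g : dual X => g z)) => // g h;
  exact: dualD. Qed.

Lemma dual_normr_le f (c : R) : 0 <= c ->
  (`|f| <= c) <-> forall x, `|f x| <= c * `|x|.
Proof. exact: dual_norm_le. Qed.

Lemma dual_normr_apply_le f x : `|f x| <= `|f| * `|x|.
Proof. exact: dual_le_norm. Qed.

Lemma exists_norming f (c : R) : 0 <= c -> c < `|f| ->
  exists2 z, `|z| <= 1 & c < f z.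
Proof.
move=> c0 cf; apply: contrapT => nz.
have fc z : `|z| <= 1 -> f z <= c.
  by move=> z1; rewrite leNgt; apply/negP => cz; apply: nz; exists z.
move: cf; rewrite ltNge => /negP; apply; apply/dual_normr_le => // x.
have [->|x0] := eqVneq x 0; first by rewrite raddf0 !normr0 mulr0.
have nx0 : 0 < `|x| by rewrite normr_gt0.
have n1 : `|(`|x|^-1 *: x)| <= 1.
  by rewrite normrZ normfV normr_id mulVf// gt_eqF.
have := fc _ n1; rewrite linearZ/= ler_pdivrMl// => h1.
have := fc (- (`|x|^-1 *: x)); rewrite normrN => /(_ n1).
rewrite linearN linearZ/= -mulrN ler_pdivrMl// => h2.
by rewrite mulrC; apply/ler_normlP.
Qed.

Lemma signsum_apply (I : finType) (f : I -> dual X) (e : {ffun I -> bool}) z :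
  signsum f e z = \sum_i (-1) ^+ e i * f i z.
Proof. by rewrite dual_sumE. Qed.

(** At a fixed point [z], the best choice of signs replaces the values [f i z] by their absolute
    values. *)
Lemma signsum_le_weak (I : finType) (f : I -> dual X) (C : R) : 0 <= C ->
  (forall e, `|signsum f e| <= C) <->
  (forall z, \sum_i `|f i z| <= C * `|z|).
Proof.
move=> C0; split=> fC.
  move=> z; pose e : {ffun I -> bool} := [ffun i => f i z < 0].
  have -> : \sum_i `|f i z| = signsum f e z.
    rewrite signsum_apply; apply: eq_bigr => i _; rewrite ffunE.
    have [fz|fz] := ltrP (f i z) 0; first by rewrite ltr0_norm// mulN1r.
    by rewrite ger0_norm// mul1r.
  rewrite (le_trans (ler_norm _))// (le_trans (dual_normr_apply_le _ _))//.
  by rewrite ler_wpM2r.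
move=> e; apply/dual_normr_le => // z.
rewrite signsum_apply (le_trans (ler_norm_sum _ _ _))// (le_trans _ (fC z))//.
by apply: ler_sum => i _; rewrite normrM normrX normrN normr1 expr1n mul1r.
Qed.

End dual_facts.

Section l1_copies.
Context {R : realType} {X : normedModType R}.

Lemma l1_normE n (a : l1 R n) : `|a| = \sum_k `|(a : 'rV[R]_n) 0 k|.
Proof. by []. Qed.

Lemma l1_isoI n (u : {linear l1 R n -> X}) (v : X -> l1 R n) (A B : R) :
  0 <= A -> 0 <= B -> cancel u v -> (forall a, `|u a| <= A * `|a|) ->
  (forall a, `|a| <= B * `|u a|) -> l1_iso u (A * B).
Proof.
move=> A0 B0 uv uA vB; exists v => //.
rewrite EFinM; apply: lee_pmul; [exact: opnorm_ge0| |exact/opnorm_leP|].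
  apply: ereal_sup_ubound; exists 0 => /=.
    by split; [exists 0; rewrite ?raddf0|rewrite normr0].
  by have := uv 0; rewrite raddf0 => ->; rewrite normr0.
apply: ge_ereal_sup => _ [_ [[a _ <-] a1] <-]; rewrite lee_fin uv.
by rewrite (le_trans (vB a))// -[leRHS]mulr1 ler_wpM2l.
Qed.

(** A homogeneous form of the distortion bound: it tests the two norms at [a] and at [u b], and so
    never has to separate the two extended real factors. *)
Lemma l1_iso_le n (u : {linear l1 R n -> X}) (K : R) : l1_iso u K ->
  forall a b, `|u a| * `|b| <= K * (`|a| * `|u b|).
Proof.
move=> [v uv uvK] a b.
have [->|a0] := eqVneq a 0; first by rewrite raddf0 !normr0 !mul0r mulr0.
have [->|b0] := eqVneq b 0; first by rewrite raddf0 !normr0 !mulr0.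
have ub0 : u b != 0.
  by apply: contra_neq b0 => ub; rewrite -(uv b) ub -(raddf0 u) uv.
have na0 : 0 < `|a| by rewrite normr_gt0.
have nb0 : 0 < `|u b| by rewrite normr_gt0.
have unit_norm (V : normedModType R) (x : V) : 0 < `|x| ->
  `|(`|x|^-1 *: x)| <= 1.
  by move=> x0; rewrite normrZ normfV normr_id mulVf// gt_eqF.
have ua : ((`|a|^-1 * `|u a|)%:E <= opnorm setT u)%E.
  apply: ereal_sup_ubound; exists (`|a|^-1 *: a).
    by split=> //; exact: unit_norm.
  by rewrite linearZ normrZ normfV normr_id.
have vb : ((`|u b|^-1 * `|b|)%:E <= opnorm (range u) v)%E.
  apply: ereal_sup_ubound; exists (`|u b|^-1 *: u b).
    by split; [exists (`|u b|^-1 *: b); rewrite ?linearZ|exact: unit_norm].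
  by rewrite -linearZ uv normrZ normfV normr_id.
have := le_trans (lee_pmul _ _ ua vb) uvK.
rewrite !lee_fin !mulr_ge0 ?invr_ge0// => /(_ isT isT).
rewrite mulrACA -invfM ler_pdivrMl ?mulr_gt0//.
by rewrite [K * _]mulrC.
Qed.

Definition unif_weak_l1 (C : R) : Prop := forall n,
  exists f : 'I_n -> dual X, (forall k, 1 <= `|f k|) /\
    forall z, \sum_k `|f k z| <= C * `|z|.

Lemma dual_of_bound (g : X -> R) (C : R) : linear g ->
  (forall z, `|g z| <= C * `|z|) -> exists f : dual X, forall z, f z = g z.
Proof.
move=> glin gC; pose g' : {linear X -> R^o} := @linear_of R X R^o g glin.
have gc : continuous g'.
  apply/linear_bounded_continuous/linear_boundedP.
  by near=> r => x; rewrite (le_trans (gC x))// ler_wpM2r//; near: r;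
    exact: nbhs_pinfty_ge.
by have gP : g \in @dual_pred R X; [rewrite inE|exists (Dual gP)].
Unshelve. all: by end_near. Qed.

Lemma unif_compl_l1_biorthogonal : has_unif_compl_l1 X ->
  exists2 C : R, 0 <= C & forall n,
    exists f : 'I_n -> dual X, exists y : 'I_n -> X,
    [/\ forall k, `|y k| <= 1, forall j k, f j (y k) = (j == k)%:R &
        forall z, \sum_k `|f k z| <= C * `|z|].
Proof.
move=> [K XK]; exists (`|K| * `|K|); first by rewrite mulr_ge0.
case=> [|n].
  exists (fun=> 0), (fun=> 0); split=> [[]|[]|z]//.
  by rewrite big_ord0 !mulr_ge0.
have [u [P [uK [rP PP] nP]]] := XK n.+1.
have uK' := l1_iso_le uK; have [v uv _] := uK.
have nPK z : `|P z| <= `|K| * `|z|.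
  apply/(opnorm_leP _ _).1 => //; rewrite (le_trans nP)// lee_fin.
  exact: ler_norm.
have uvP z : u (v (P z)) = P z.
  have [a _ <-] : range u (P z) by rewrite -rP; exists z.
  by rewrite uv.
(* The scale [c] is attained at a unit vector, so [uK'] bounds [c * |b|] by [K * |u b|]; its
   maximality gives the rescaled images norm at most 1. *)
have [k0 _ k0P] := @arg_maxP _ R _ ord0 predT
  (fun k => `|u (delta_mx 0 k : 'rV_n.+1)|) isT.
set c := `|u _| in k0P.
have e_norm k : `|(delta_mx 0 k : 'rV_n.+1) : l1 R n.+1| = 1.
  rewrite l1_normE (bigD1 k)//= mxE !eqxx normr1 big1 ?addr0// => j jk.
  by rewrite mxE/= (negbTE jk) normr0.
have c0 : 0 < c.
  rewrite normr_gt0; apply/eqP => u0.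
  have := uv (delta_mx 0 k0 : 'rV_n.+1); rewrite u0 -(raddf0 u) uv => d0.
  by have := e_norm k0; rewrite -d0 normr0 => /eqP; rewrite eq_sym oner_eq0.
pose g k z : R := c * (v (P z) : 'rV_n.+1) 0 k.
have gsum z : \sum_k `|g k z| <= `|K| * `|K| * `|z|.
  under eq_bigr do rewrite normrM (gtr0_norm c0).
  rewrite -mulr_sumr -l1_normE.
  rewrite (le_trans (uK' _ _))// e_norm mul1r uvP.
  rewrite -mulrA (@le_trans _ _ (`|K| * `|P z|))//.
    by rewrite ler_wpM2r// ler_norm.
  by rewrite ler_wpM2l.
(* [v] is a bare function; linearity is pulled back through the injective map [u]. *)
have vP_linear : linear (fun z => v (P z)).
  move=> a x y; apply: (can_inj uv).
  by rewrite uvP !linearP/= !uvP.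
have /choice[f fE] k : exists f : dual X, forall z, f z = g k z.
  apply: (@dual_of_bound _ (`|K| * `|K|)).
    move=> a x y; rewrite /g vP_linear !mxE mulrDr; congr (_ + _).
    by rewrite mulrCA.
  move=> z; apply: le_trans (gsum z).
  by rewrite (bigD1 k)//= lerDl sumr_ge0.
exists f, (fun k => c^-1 *: u (delta_mx 0 k : 'rV_n.+1)); split=> [k|j k|z].
- by rewrite normrZ normfV (gtr0_norm c0) ler_pdivrMl// mulr1; exact: k0P.
- have [z _ uz] : range P (u (delta_mx 0 k : 'rV_n.+1)).
    by rewrite rP; exists (delta_mx 0 k : 'rV_n.+1).
  by rewrite linearZ/= fE /g -uz PP uz uv /GRing.scale/= mulKf ?(lt0r_neq0
    c0)// mxE ?eqxx.
- by under eq_bigr do rewrite fE; exact: gsum.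
Qed.

Lemma unif_compl_l1_weak : has_unif_compl_l1 X -> exists C, unif_weak_l1 C.
Proof.
move=> /unif_compl_l1_biorthogonal[C _ XC]; exists C => n.
have [f [y [y1 fy fC]]] := XC n; exists f; split=> // k.
have := dual_normr_apply_le (f k) (y k); rewrite fy eqxx normr1 => /le_trans;
  apply.
by rewrite ler_piMr.
Qed.

End l1_copies.

(** * Trivial cotype of the dual and complemented copies of l1 *)

Section trivial_cotype_dual.
Context {R : realType} {X : normedModType R}.

Lemma natr_powR_unbounded (s B : R) : 0 < s -> exists n : nat, B < n%:R `^ s.
Proof.
move=> s0; have [n nB] := exists_truncn_gt (`|B| `^ s^-1).
exists n; rewrite (le_lt_trans (ler_norm B))//.
have <- : (`|B| `^ s^-1) `^ s = `|B|.
  by rewrite -powRrM mulVf ?gt_eqF// powRr1.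
by apply: gt0_ltr_powR; rewrite ?nnegrE ?powR_ge0.
Qed.

(** All sign sums of the [n] functionals are at most [C] in norm, so cotype [q] would bound
    [n^(1/q)]. *)
Lemma trivial_cotype_of_weak_l1 (C : R) : @unif_weak_l1 R X C ->
  trivial_cotype (dual X).
Proof.
move=> hC q q2 [D hD].
have q0 : 0 < q by rewrite (lt_le_trans _ q2).
have [n nB] : exists n : nat, `|D| * `|C| < n%:R `^ q^-1.
  by apply: natr_powR_unbounded; rewrite invr_gt0.
have [f [f1 fC]] := hC n.
move: nB; rewrite ltNge => /negP; apply.
have fC' e : `|signsum f e| <= `|C|.
  move: e; apply/signsum_le_weak => // z.
  by rewrite (le_trans (fC z))// ler_wpM2r// ler_norm.
apply: (@le_trans _ _ ((\sum_(k < n) `|f k| `^ q) `^ q^-1)).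
  apply: ge0_ler_powR; rewrite ?nnegrE ?invr_ge0 ?sumr_ge0//; first exact: ltW.
  rewrite -[n in n%:R]card_ord -sumr_const; apply: ler_sum => k _.
  apply: (@le_trans _ _ (1 `^ q)); first by rewrite powR1.
  by apply: ge0_ler_powR; rewrite ?nnegrE// ltW.
apply: le_trans (hD n f) _.
rewrite (@le_trans _ _ (`|D| * Num.sqrt (rad f)))//.
  by rewrite /rad card_ord ler_wpM2r ?sqrtr_ge0// ler_norm.
rewrite ler_wpM2l// -[leRHS]ger0_norm// -sqrtr_sqr ler_wsqrtr//.
rewrite /rad ler_pdivrMl ?exprn_gt0//.
apply: (@le_trans _ _ (\sum_(e : {ffun 'I_n -> bool}) `|C| ^+ 2)).
  by apply: ler_sum => e _; rewrite lerXn2r ?nnegrE.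
rewrite sumr_const card_ffun card_bool -[_ *+ 2 ^ _]mulr_natl natrX card_ord.
by [].
Qed.

Lemma trivial_cotype_almost_flat (Y : normedModType R) :
  trivial_cotype Y -> @almost_flat R Y.
Proof.
move=> tY; have [//|[q [C [q1 _ _ hC]]]] := @almost_flat_or_power_summing R Y.
have := tY q%:R; rewrite ler_nat => /(_ q1)[].
exact: power_summing_has_cotype (ltnW q1) hC.
Qed.

(* The total mass of the functionals at a point almost norming one of them is
   close to [1], so the matrix of their values at such points is diagonally
   dominant. *)
Lemma almost_flat_unif_compl_l1 : @almost_flat R (dual X) ->
  has_unif_compl_l1 X.
Proof.
(* [4 = 2 * 2]: both [u] and the coordinate map [T] have norm at most 2. The tolerance 1/16 leaves
   room for diagonal entries above 7/8 and row masses at most 17/16; the off-diagonal mass is then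
   at most 3/16, and [7/8 - 3/16 >= 1/2] bounds the matrix below. *)
move=> flat; exists 4 => n.
have d1 : 0 < (16^-1 : R) < 1 by apply/andP; split; lra.
have [f [f1 f_signs]] := flat n _ d1.
have {f_signs} fw : forall z, \sum_k `|f k z| <= (1 + 16^-1) * `|z|.
  by apply/signsum_le_weak => //; lra.
have /choice[y yP] k : exists y, `|y| <= 1 /\ 7 / 8 < f k y.
  have [||y y1 fy] := @exists_norming _ _ (f k) (7 / 8); [lra| |by exists y].
  by apply: lt_le_trans (f1 k); lra.
pose A : 'M[R]_n := \matrix_(j, k) f k (y j).
have AE j k : A j k = f k (y j) by rewrite mxE.
have offdiag j : \sum_(k | k != j) `|f k (y j)| <= 3 / 16.
  have := le_trans (fw (y j)) (ler_wpM2l _ (yP j).1).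
  rewrite (bigD1 j)//= mulr1 => /(_ _) h.
  have := yP j; have := ler_norm (f j (y j)).
  have {}h := h ltac:(lra); move: h; lra.
have A_below (a : 'rV[R]_n) :
    2^-1 * \sum_k `|a 0 k| <= \sum_k `|(a *m A) 0 k|.
  apply: (@le_trans _ _ (\sum_k (7 / 8 * `|a 0 k| -
      \sum_(j | j != k) `|a 0 j| * `|f k (y j)|))); last first.
    apply: ler_sum => k _; rewrite mxE [X in _ <= `|X|](bigD1 k)//= AE.
    rewrite (@le_trans _ _ (`|a 0 k * f k (y k)| -
      `|\sum_(j | j != k) a 0 j * A j k|))//; last first.
      rewrite -[X in _ - X]normrN -[X in _ <= `|_ + X|]opprK.
      exact: lerB_dist.
    rewrite lerB//.
      rewrite normrM mulrC ler_wpM2l//.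
      by rewrite (le_trans (ltW (yP k).2))// ler_norm.
    rewrite (le_trans (ler_norm_sum _ _ _))//.
    by apply: ler_sum => j _; rewrite AE normrM.
  rewrite sumrB (exchange_big_dep predT)//=.
  rewrite -[X in _ <= X - _]mulr_sumr lerBrDr -lerBrDl -mulrBl.
  rewrite mulr_sumr; apply: ler_sum => j _.
  rewrite -mulr_sumr mulrC ler_wpM2r//.
  under eq_bigl do rewrite eq_sym.
  by rewrite (le_trans (offdiag j))//; lra.
have A_unit : A \in unitmx.
  rewrite -row_free_unit -kermx_eq0; apply/eqP/row_matrixP => i.
  rewrite row0; have kA : row i (kermx A) *m A = 0.
    by rewrite -row_mul mulmx_ker row0.
  have := A_below (row i (kermx A)); rewrite kA.
  rewrite [X in _ <= X]big1 => [|k _]; last by rewrite mxE normr0.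
  rewrite pmulr_rle0// => s0.
  apply: (@normr0_eq0 _ (l1 R n)); apply/le_anti.
  by rewrite normr_ge0 andbT.
pose T z : l1 R n := \row_k f k z.
pose u (a : l1 R n) : X := \sum_j ((a : 'rV_n) *m invmx A) 0 j *: y j.
have T_linear : linear T.
  by move=> c x z; apply/rowP => k; rewrite !mxE linearP.
have u_linear : linear u.
  move=> c a b; rewrite /u scaler_sumr -big_split/=; apply: eq_bigr => j _.
  by rewrite mulmxDl -scalemxAl !mxE scalerDl scalerA.
have uT_linear : linear (u \o T).
  by move=> c x z; rewrite /= T_linear u_linear.
have uK : cancel u T.
  move=> a; apply/rowP => k; rewrite mxE /u linear_sum/=.
  rewrite -[in RHS](mulmxKV A_unit a) mxE; apply: eq_bigr => j _.
  by rewrite linearZ/= AE.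
have T_norm z : `|T z| <= 2 * `|z|.
  rewrite l1_normE; under eq_bigr do rewrite mxE.
  by rewrite (le_trans (fw z))// ler_wpM2r//; lra.
have u_norm a : `|u a| <= 2 * `|a|.
  have := A_below ((a : 'rV_n) *m invmx A); rewrite mulmxKV// -l1_normE.
  rewrite ler_pdivrMl// => /(le_trans _); apply.
  rewrite (le_trans (ler_norm_sum _ _ _))//; apply: ler_sum => j _.
  by rewrite normrZ ler_piMr// (yP j).1.
pose P := linear_of uT_linear.
exists (linear_of u_linear), P; split.
- rewrite (_ : 4 = 2 * 2); last by ring.
  apply: (@l1_isoI _ _ n _ T) => // a /=.
  by rewrite -{1}(uK a).
- split=> [|x /=]; last by rewrite uK.
  apply/seteqP; split=> [_ [x _ <-]|_ [a _ <-]]; first by exists (T x).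
  by exists (u a) => //=; rewrite uK.
- apply/opnorm_leP => // x /=.
  rewrite (le_trans (u_norm _))// (_ : 4 = 2 * 2) ?mulrA -?mulrA; last by ring.
  by rewrite ler_wpM2l.
Qed.

End trivial_cotype_dual.

(** * Factorization of weakly summable sequences of functionals *)

Section scalar_inequalities.
Variable R : realType.
Implicit Types a b : R.

Lemma weighted_amgm a b n : 0 <= a -> 0 <= b ->
  n.+1%:R * b ^+ n * a <= a ^+ n.+1 + n%:R * b ^+ n.+1.
Proof.
move=> a0 b0; elim: n => [|n IHn]; first by rewrite expr0 !mul1r mul0r addr0.
have := ler_wpM2l a0 IHn.
have : 0 <= n.+1%:R * b ^+ n * (a - b) ^+ 2.
  by rewrite mulr_ge0 ?sqr_ge0// mulr_ge0 ?exprn_ge0.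
rewrite (exprS a n.+1) !(exprS b) -[n.+2%:R]natr1 -[n.+1%:R]natr1.
set c := b ^+ n; set d := a ^+ n.+1; set m := n%:R; rewrite !expr2 => h1 h2.
lra.
Qed.

(** The tangent at [b] lies below an even power on the whole line; [weighted_amgm] is the case of
    nonnegative arguments. *)
Lemma even_expr_tangent a b q : ~~ odd q.+1 ->
  b ^+ q.+1 - q.+1%:R * b ^+ q * (b - a) <= a ^+ q.+1.
Proof.
move=> q_even.
have qE (c : R) : c ^+ q.+1 = `|c| ^+ q.+1.
  by rewrite -normrX ger0_norm//; exact: exprn_even_ge0.
have := weighted_amgm q (normr_ge0 a) (normr_ge0 b); rewrite -!qE.
have : q.+1%:R * b ^+ q * a <= q.+1%:R * `|b| ^+ q * `|a|.
  rewrite -!mulrA ler_wpM2l// (le_trans (ler_norm _))//.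
  by rewrite normrM normrX.
rewrite mulrBr -[q.+1%:R * b ^+ q * b]mulrA -exprSr -[q.+1%:R]natr1; lra.
Qed.

Lemma dyadic_layer_le b m : b <= 2 ^+ m ->
  b <= 1 + \sum_(i < m) 2 ^+ i * (2 ^+ i < b)%R%:R.
Proof.
have full k : 1 + \sum_(i < k) 2 ^+ i = 2 ^+ k :> R.
  elim: k => [|k IHk]; first by rewrite big_ord0 addr0.
  by rewrite big_ord_recr/= addrA IHk exprS; ring.
elim: m => [|m IHm] bm; first by rewrite big_ord0 addr0.
rewrite big_ord_recr/=; have [b1|b1] := ltP (2 ^+ m) b; last first.
  by rewrite mulr0 addr0 IHm.
rewrite mulr1 (le_trans bm)// -full big_ord_recr/= lerD2l lerD2r.
apply: ler_sum => i _; rewrite (le_lt_trans _ b1) ?mulr1//.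
by rewrite ler_weXn2l ?ler1n// ltnW.
Qed.

End scalar_inequalities.

Section summing_weights.
Context {R : realType} {X : normedModType R}.
Variables (q : nat) (C : R).
Hypothesis q_even : ~~ odd q.+1.
Hypothesis summing : forall (I : finType) (f : I -> dual X),
  (forall z, \sum_i `|f i z| <= `|z|) -> \sum_i `|f i| ^+ q.+1 <= C.

(* Pisier's extremal argument: take [a] and [z] nearly maximizing
   [\sum_j (\sum_k a j k * x k (z j)) ^ q.+1] under [\sum_j `|a j k| <= 1].
   Cutting every [a j] off [A] leaves room for one more vector supported on [A],
   whose contribution is thus controlled by the derivative of the sum, which is
   additive in [A]. *)
Lemma exists_summing_weights n (x : 'I_n -> dual X) :
  (forall z, \sum_k `|x k z| <= `|z|) ->
  exists w : 'I_n -> R, [/\ forall k, 0 <= w k,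
    \sum_k w k <= q.+1%:R * C + 1 &
    forall (A : pred 'I_n) z, `|z| <= 1 ->
      (\sum_(k | A k) `|x k z|) ^+ q.+1 <= \sum_(k | A k) w k].
Proof.
move=> x1.
pose V := [set v | exists (J : finType) (a : J -> 'I_n -> R) (z : J -> X),
  [/\ forall k, \sum_j `|a j k| <= 1, forall j, `|z j| <= 1 &
      v = \sum_j (\sum_k a j k * x k (z j)) ^+ q.+1]].
have V0 : V 0.
  exists void, (fun=> fun=> 0), (fun=> 0); split=> [k|[]|]//.
    by rewrite big1 => [|[]].
  by rewrite big1 => [|[]].
have VC v : V v -> v <= C.
  move=> [J [a [z [a1 z1 ->]]]].
  pose f j := \sum_k a j k *: x k.
  have fE j y : f j y = \sum_k a j k * x k y by rewrite dual_sumE.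
  apply: (@le_trans _ _ (\sum_j `|f j| ^+ q.+1)).
    apply: ler_sum => j _; rewrite -fE (le_trans (ler_norm _))// normrX.
    rewrite lerXn2r ?nnegrE// (le_trans (dual_normr_apply_le _ _))//.
    by rewrite ler_piMr.
  apply: summing => y; rewrite (le_trans _ (x1 y))//.
  apply: (@le_trans _ _ (\sum_j \sum_k `|a j k| * `|x k y|)).
    apply: ler_sum => j _; rewrite fE (le_trans (ler_norm_sum _ _ _))//.
    by apply: ler_sum => k _; rewrite normrM.
  rewrite exchange_big/=; apply: ler_sum => k _.
  by rewrite -mulr_suml ler_piMl.
have V_sup : has_sup V by split; [exists 0|exists C => v /VC].
(* The defect of the near-maximum. Adding [e] to each of the [n] weights costs less than 1 in total
   and pays for the defect on every nonempty [A]; the empty set, having no weight to pay with, is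
   treated apart. *)
pose e : R := n.+1%:R^-1.
have e0 : 0 < e by rewrite invr_gt0.
have [v [J [a [z [a1 z1 vE]]]] vS] := sup_adherent e0 V_sup.
pose u j := \sum_k a j k * x k (z j).
(* The derivative of the sum of powers along the [k]-th coefficients. By homogeneity the [l k] add
   up to [q.+1 * v]. *)
pose l k := q.+1%:R * \sum_j u j ^+ q * (a j k * x k (z j)).
have main (A : pred 'I_n) y : `|y| <= 1 ->
    (\sum_(k | A k) `|x k y|) ^+ q.+1 <= e + \sum_(k | A k) l k.
  move=> y1; pose s := \sum_(k | A k) `|x k y|.
  pose v' j := \sum_(k | A k) a j k * x k (z j).
  have : V (\sum_j (u j - v' j) ^+ q.+1 + s ^+ q.+1).
    pose a' (j : J + unit) k := match j with
      | inl j => if A k then 0 else a j k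
      | inr _ => if A k then (-1) ^+ (x k y < 0)%R else 0 end.
    pose z' (j : J + unit) := if j is inl j then z j else y.
    exists (J + unit)%type, a', z'; split=> [k|[]//|].
      rewrite big_sumType/= (big_pred1 tt); last by case.
      case: (A k); last by rewrite normr0 addr0.
      by rewrite big1 ?normr0// add0r normrX normrN1 expr1n.
    rewrite big_sumType/= (big_pred1 tt)/=; last by case.
    congr (_ + _ ^+ _).
      apply: eq_bigr => j _; congr (_ ^+ _).
      rewrite /u /v' [\sum_(k | A k) _]big_mkcond/= -sumrB.
      by apply: eq_bigr => k _; case: (A k); rewrite ?subrr ?mul0r ?subr0.
    rewrite /s big_mkcond/=; apply: eq_bigr => k _.
    case: (A k); last by rewrite mul0r.
    have [xy|xy] := ltP (x k y) 0; first by rewrite ltr0_norm// mulN1r.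
    by rewrite ger0_norm// mul1r.
  move=> /(ub_le_sup V_sup.2).
  have : \sum_j (u j ^+ q.+1 - q.+1%:R * u j ^+ q * v' j) <=
      \sum_j (u j - v' j) ^+ q.+1.
    apply: ler_sum => j _;
      rewrite (le_trans _ (even_expr_tangent _ (u j) q_even))//.
    by rewrite subKr.
  have -> : \sum_(k | A k) l k = \sum_j q.+1%:R * u j ^+ q * v' j.
    rewrite /l -mulr_sumr exchange_big/= mulr_sumr; apply: eq_bigr => j _.
    by rewrite -mulr_sumr mulrA.
  rewrite sumrB -/s; move: vS; rewrite vE -/(u _); lra.
(* Since [a] and [z] are only nearly maximal, [l k] may be slightly negative; testing [main] on one
   index at the point 0 bounds the deficit by [e]. *)
have l_ge k : 0 <= l k + e.
  have := main (pred1 k) 0; rewrite normr0 => /(_ ler01).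
  rewrite !big_pred1_eq raddf0 normr0 expr0n/=; lra.
exists (fun k => l k + e); split=> // [|A y y1].
  rewrite big_split/= lerD//.
    rewrite /l -mulr_sumr ler_wpM2l// exchange_big/=.
    have vC : v <= C by apply: VC; exists J, a, z.
    rewrite (le_trans _ vC)// vE [leLHS](eq_bigr (fun j => u j ^+ q.+1))//.
    by move=> j _; rewrite -mulr_sumr -exprSr.
  rewrite sumr_const card_ord -mulr_natr mulrC ler_pdivrMr// mul1r.
  by rewrite ler_nat.
have [A0|/existsP[k Ak]] := boolP [forall k, ~~ A k].
  move/forallP: A0 => A0; rewrite !big_pred0 ?expr0n// => k; exact/negbTE/A0.
rewrite negbK in Ak; apply: (le_trans (main A y y1)).
rewrite big_split/= [leLHS]addrC lerD2l (bigD1 k)//= lerDl.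
by rewrite sumr_ge0// => j _; exact: ltW.
Qed.

(** Chebyshev on dyadic level sets: the weight of the set where [b] exceeds [2^i] is at most
    [2^(-2 (q+1) i)], so the functionals on it sum to at most [4^-i]. The layers contribute
    [2^i 4^-i], in total at most 2, to which [dyadic_layer_le] adds 1. With exponent [q.+1] in place
    of [2 * q.+1] this series would not converge. *)
Lemma summing_weights_bound n (x : 'I_n -> dual X) (w : 'I_n -> R) :
  (forall z, \sum_k `|x k z| <= `|z|) -> (forall k, 0 <= w k) ->
  (forall (A : pred 'I_n) z, `|z| <= 1 ->
    (\sum_(k | A k) `|x k z|) ^+ q.+1 <= \sum_(k | A k) w k) ->
  forall b : 'I_n -> R, (forall k, 0 <= b k) ->
    \sum_k w k * b k ^+ (2 * q.+1) <= 1 ->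
  forall z, `|z| <= 1 -> \sum_k b k * `|x k z| <= 3.
Proof.
move=> x1 w0 xw b b0 wb z z1.
have [m bm] : exists m, forall k, b k <= 2 ^+ m.
  have [m mb] := exists_truncn_gt (\sum_k b k); exists m => k.
  rewrite (@le_trans _ _ m%:R)//.
    rewrite ltW// (le_lt_trans _ mb)// (bigD1 k)//= lerDl sumr_ge0//.
  by rewrite -natrX ler_nat ltnW// ltn_expl.
have layer i : \sum_(k | 2 ^+ i < b k) `|x k z| <= (2^-1 ^+ i) ^+ 2.
  rewrite -(@ler_pXn2r _ q.+1)// ?nnegrE ?sumr_ge0 ?exprn_ge0//.
  apply: le_trans (xw _ z z1) _.
  have p0 : 0 < (2 ^+ i) ^+ (2 * q.+1) :> R by rewrite !exprn_gt0.
  rewrite exprVn -exprM exprVn -[leRHS]mul1r ler_pdivlMr// mulrC.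
  apply: le_trans wb; rewrite [leRHS](bigID (fun k => 2 ^+ i < b k))/=.
  rewrite -[leLHS]addr0 lerD ?sumr_ge0// => [|k _]; last first.
    by rewrite mulr_ge0 ?exprn_ge0.
  rewrite mulr_sumr; apply: ler_sum => k bk; rewrite mulrC ler_wpM2l//.
  by rewrite lerXn2r ?nnegrE ?exprn_ge0// ltW.
apply: (@le_trans _ _ (\sum_k (`|x k z| +
    \sum_(i < m) 2 ^+ i * ((2 ^+ i < b k)%R%:R * `|x k z|)))).
  apply: ler_sum => k _;
    have := ler_wpM2r (normr_ge0 (x k z)) (dyadic_layer_le (bm k)).
  rewrite mulrDl mul1r mulr_suml => /le_trans; apply; rewrite lerD2l.
  by apply: ler_sum => i _; rewrite mulrA.
rewrite big_split/= exchange_big/=.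
apply: (@le_trans _ _ (1 + 2)); last by lra.
rewrite lerD//; first by rewrite (le_trans (x1 z)).
apply: le_trans (sum_geometric_half_le R m); apply: ler_sum => i _.
rewrite -mulr_sumr.
have -> : \sum_k (2 ^+ i < b k)%R%:R * `|x k z| = \sum_(k | 2 ^+ i < b k) `|x k
  z|.
  rewrite [RHS]big_mkcond/=; apply: eq_bigr => k _.
  by case: (_ < _); rewrite ?mul1r ?mul0r.
rewrite (le_trans (ler_wpM2l _ (layer i))) ?exprn_ge0//.
by rewrite expr2 mulrA -exprMn mulfV ?expr1n ?mul1r.
Qed.

End summing_weights.

Lemma powR_div (R : realType) (a b p : R) : 0 <= a -> 0 <= b ->
  (a / b) `^ p = a `^ p / b `^ p.
Proof.
move=> a0 b0; rewrite powRM ?invr_ge0//.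
by rewrite -[b^-1]powR_inv1// -powRrM mulN1r powRN.
Qed.

(** * Duality between the exponents [r] and [r / (r - 1)] *)

Section lp_duality.
Context {R : realType}.
Variable r : nat.
Hypothesis r2 : (1 < r)%N.

Let r_gt0 : (0 < r)%N.
Proof. exact: ltnW. Qed.

Definition conj_exp : R := r%:R / (r%:R - 1).

Let r1 : 0 < r%:R - 1 :> R.
Proof. by rewrite subr_gt0 ltr1n. Qed.

Let r0 : 0 < r%:R :> R.
Proof. by rewrite ltr0n. Qed.

Lemma conj_exp_gt1 : 1 < conj_exp.
Proof. by rewrite /conj_exp ltr_pdivlMr// mul1r gtrBl. Qed.

Let p0 : 0 < conj_exp.
Proof. exact: lt_trans ltr01 conj_exp_gt1. Qed.

Let conj_expB1 : (conj_exp - 1) * r%:R = conj_exp.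
Proof. by rewrite /conj_exp; field; rewrite gt_eqF. Qed.

Let conj_expV : r%:R^-1 + conj_exp^-1 = 1.
Proof. by rewrite /conj_exp; field; rewrite !gt_eqF. Qed.

(** The parameter [r] is the dual exponent: [lp r] is the norm of exponent [r / (r - 1)], and
    norming coefficients lie in the unit ball for [r], where powers are natural. *)
Definition lp n (t : 'I_n -> R) : R := lp_norm conj_exp%:E t.

Lemma lp_ge0 n (t : 'I_n -> R) : 0 <= lp t.
Proof. exact: powR_ge0. Qed.

Lemma lp_powR n (t : 'I_n -> R) : lp t `^ conj_exp = \sum_k `|t k| `^ conj_exp.
Proof.
rewrite /lp /lp_norm -powRrM mulVf ?gt_eqF// powRr1//.
by rewrite sumr_ge0// => k _; rewrite powR_ge0.
Qed.

Lemma lp_eq0 n (t : 'I_n -> R) : lp t = 0 -> forall k, t k = 0.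
Proof.
move=> t0 k; have := lp_powR t; rewrite t0 powR0 ?gt_eqF// => /esym/eqP.
rewrite psumr_eq0 => [/allP/(_ k)|j _]; last exact: powR_ge0.
rewrite mem_index_enum => /(_ isT)/=.
by rewrite powR_eq0 normr_eq0 => /andP[/eqP].
Qed.

Lemma lp_hoelder n (t c : 'I_n -> R) (G : R) : 0 <= G ->
  (forall k, 0 <= c k) -> \sum_k c k ^+ r <= G ^+ r ->
  \sum_k c k * `|t k| <= G * lp t.
Proof.
move=> G0 c0 cG.
have [L0|L0] := eqVneq (lp t) 0.
  by rewrite L0 mulr0 big1// => k _; rewrite (lp_eq0 L0) normr0 mulr0.
have {}L0 : 0 < lp t by rewrite lt_neqAle eq_sym L0 lp_ge0.
move: G0; rewrite le_eqVlt => /predU1P[G0|G0].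
  rewrite -G0 mul0r big1// => k _; move: cG; rewrite -G0 expr0n (gtn_eqF r_gt0).
  move=> cG; have : c k ^+ r <= 0.
    by apply: le_trans cG; rewrite (bigD1 k)//= lerDl sumr_ge0// => j _;
      rewrite exprn_ge0.
  move=> ck; have /eqP : c k ^+ r = 0 by apply/le_anti; rewrite ck exprn_ge0.
  by rewrite expf_eq0 => /andP[_ /eqP ->]; rewrite mul0r.
have young k : c k / G * (`|t k| / lp t) <=
    (c k ^+ r / G ^+ r) / r%:R + (`|t k| `^ conj_exp / lp t `^ conj_exp) /
      conj_exp.
  have := @conjugate_powR R (c k / G) (`|t k| / lp t) r%:R conj_exp.
  rewrite !divr_ge0 ?c0 ?lp_ge0 ?(ltW G0)// => /(_ isT isT r0 p0 conj_expV).
  rewrite powR_mulrn ?divr_ge0 ?c0 ?(ltW G0)// expr_div_n.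
  by rewrite powR_div ?lp_ge0.
have : \sum_k c k / G * (`|t k| / lp t) <= 1.
  apply: le_trans (ler_sum _ (fun k _ => young k)) _.
  rewrite big_split/= -!mulr_suml -lp_powR.
  rewrite [X in _ + X / _]mulfV ?mul1r; last by rewrite gt_eqF// powR_gt0.
  rewrite -[leRHS]conj_expV lerD2r ler_piMl ?invr_ge0//.
  by rewrite ler_pdivrMr ?exprn_gt0// mul1r.
have -> : \sum_k c k / G * (`|t k| / lp t) = (G * lp t)^-1 * \sum_k c k * `|t
  k|.
  by rewrite mulr_sumr; apply: eq_bigr => k _; rewrite mulrACA -invfM mulrC.
by rewrite ler_pdivrMl ?mulr_gt0// mulr1.
Qed.

Lemma lp_norming n (t : 'I_n -> R) : exists c : 'I_n -> R,
  [/\ forall k, 0 <= c k, \sum_k c k ^+ r <= 1 & \sum_k c k * `|t k| = lp t].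
Proof.
have [L0|L0] := eqVneq (lp t) 0.
  exists (fun=> 0); split=> //; last by rewrite L0 big1// => k _; rewrite mul0r.
  by rewrite big1// => k _; rewrite expr0n (gtn_eqF r_gt0).
have {}L0 : 0 < lp t by rewrite lt_neqAle eq_sym L0 lp_ge0.
have nt k : 0 <= `|t k| / lp t by rewrite divr_ge0// ltW.
have sum1 : \sum_k (`|t k| / lp t) `^ conj_exp = 1.
  transitivity (\sum_k `|t k| `^ conj_exp / lp t `^ conj_exp).
    by apply: eq_bigr => k _; rewrite powR_div ?lp_ge0.
  by rewrite -mulr_suml -lp_powR mulfV// gt_eqF// powR_gt0.
exists (fun k => (`|t k| / lp t) `^ (conj_exp - 1)); split=> [k||].
- exact: powR_ge0.
- rewrite -[leRHS]sum1; apply: ler_sum => k _.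
  by rewrite -powR_mulrn ?powR_ge0// -powRrM conj_expB1.
- rewrite -[RHS]mul1r -[X in _ = X * _]sum1 mulr_suml; apply: eq_bigr => k _.
  rewrite -[X in _ = X * _]mulr_powRB1// [RHS]mulrAC divfK ?gt_eqF//.
  by rewrite mulrC.
Qed.

Lemma norming_le1 n (c : 'I_n -> R) : (forall k, 0 <= c k) ->
  \sum_k c k ^+ r <= 1 -> forall k, c k <= 1.
Proof.
move=> c0 c1 k; rewrite -(@expr_le1 _ r)//.
rewrite (le_trans _ c1)// (bigD1 k)//= lerDl sumr_ge0// => j _.
by rewrite exprn_ge0.
Qed.

Lemma lp_lipschitz n (s t : 'I_n -> R) : lp t <= lp s + \sum_k `|t k - s k|.
Proof.
have [c [c0 c1 <-]] := lp_norming t.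
apply: (@le_trans _ _ (\sum_k (c k * `|s k| + `|t k - s k|))).
  apply: ler_sum => k _.
  have ck := norming_le1 c0 c1 k.
  rewrite (@le_trans _ _ (c k * (`|s k| + `|t k - s k|)))//.
    by rewrite ler_wpM2l// -lerBlDl lerB_dist.
  by rewrite mulrDr lerD2l ler_piMl.
rewrite big_split/= lerD2r -[lp s]mul1r.
by apply: lp_hoelder => //; rewrite expr1n.
Qed.

Lemma lp_le_sum n (t : 'I_n -> R) : lp t <= \sum_k `|t k|.
Proof.
have [c [c0 c1 <-]] := lp_norming t; apply: ler_sum => k _.
by rewrite ler_piMl// (norming_le1 c0 c1).
Qed.

Lemma lpZ n (a : R) (t : 'I_n -> R) : 0 <= a ->
  lp (fun k => a * t k) = a * lp t.
Proof.
move=> a0; rewrite /lp /lp_norm.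
under eq_bigr do rewrite normrM (ger0_norm a0) powRM//.
rewrite -mulr_sumr powRM ?powR_ge0//; last first.
  by rewrite sumr_ge0// => k _; rewrite powR_ge0.
by rewrite -powRrM mulfV ?gt_eqF// powRr1.
Qed.

(** By duality: the l2-normalized coefficients are at most 1, so their [r]-th powers are at most
    their squares, as [r >= 2]. *)
Lemma l2_le_lp n (t : 'I_n -> R) : Num.sqrt (\sum_k t k ^+ 2) <= lp t.
Proof.
set D := Num.sqrt _.
have [D0|D0] := eqVneq D 0; first by rewrite D0 lp_ge0.
have {}D0 : 0 < D by rewrite lt_neqAle eq_sym D0 sqrtr_ge0.
have DE : \sum_k `|t k| ^+ 2 = D ^+ 2.
  rewrite sqr_sqrtr; last by rewrite sumr_ge0// => k _; rewrite sqr_ge0.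
  by apply: eq_bigr => k _; rewrite real_normK ?num_real.
have c0 k : 0 <= `|t k| / D by rewrite divr_ge0// ltW.
have c2 : \sum_k (`|t k| / D) ^+ 2 <= 1.
  under eq_bigr do rewrite expr_div_n.
  by rewrite -mulr_suml DE mulfV// expf_neq0// gt_eqF.
have cr : \sum_k (`|t k| / D) ^+ r <= 1 ^+ r.
  rewrite expr1n (le_trans _ c2)//; apply: ler_sum => k _.
  rewrite ler_wiXn2l//.
  rewrite -(@expr_le1 _ 2)// (le_trans _ c2)// (bigD1 k)//= lerDl sumr_ge0//
    => j _.
  by rewrite exprn_ge0.
have := lp_hoelder t ler01 c0 cr; rewrite mul1r; apply: le_trans.
under eq_bigr do rewrite mulrAC -expr2.
by rewrite -mulr_suml DE expr2 mulfK// gt_eqF.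
Qed.

End lp_duality.

(** * Convexity of the free norm from summing weights *)

Section Hfin_lp.
Context {R : realType} {E : normedModType R}.

Lemma weakly1P n (x : 'I_n -> dual E) :
  weakly1 x <-> forall z, \sum_k `|x k z| <= `|z|.
Proof.
split=> [x1 z|x1 z z1]; last exact: le_trans (x1 z) z1.
have [->|z0] := eqVneq z 0.
  by rewrite normr0 big1// => k _; rewrite raddf0 normr0.
have nz0 : 0 < `|z| by rewrite normr_gt0.
have := x1 (`|z|^-1 *: z); rewrite normrZ normfV normr_id mulVf ?gt_eqF//.
move=> /(_ (lexx _)); under eq_bigr do rewrite linearZ/= normrM normfV normr_id.
by rewrite -mulr_sumr ler_pdivrMl// mulr1.
Qed.

Variables (q : nat) (C : R).
Hypotheses (q_even : ~~ odd q.+1) (C_ge0 : 0 <= C).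
Hypothesis summing : forall (I : finType) (f : I -> dual E),
  (forall z, \sum_i `|f i z| <= `|z|) -> \sum_i `|f i| ^+ q.+1 <= C.

Let W : R := q.+1%:R * C + 1.

(** By [summing_weights_bound] the functionals [b k / (3 * B) *: x k] are weakly 1-summable;
    positive homogeneity of [f] then takes the factors out. *)
Lemma Hfin_weighted_sum_le n (x : 'I_n -> dual E) (w b : 'I_n -> R) (B : R) :
  (forall z, \sum_k `|x k z| <= `|z|) -> (forall k, 0 <= w k) ->
  (forall (A : pred 'I_n) z, `|z| <= 1 ->
    (\sum_(k | A k) `|x k z|) ^+ q.+1 <= \sum_(k | A k) w k) ->
  (forall k, 0 <= b k) -> 0 <= B ->
    \sum_k w k * b k ^+ (2 * q.+1) <= B ^+ (2 * q.+1) ->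
  forall f : Hfin E, \sum_k b k * `|f (x k)| <= 3 * B * `|f|.
Proof.
move=> x1 w0 xw b0 B0 wB f.
(* [B] may vanish, so the division is by a slightly larger [D]. *)
suff pos D : 0 < D -> \sum_k w k * b k ^+ (2 * q.+1) <= D ^+ (2 * q.+1) ->
    \sum_k b k * `|f (x k)| <= 3 * D * `|f|.
  apply/ler_addgt0Pl => e e0.
  have d0 : 0 < e / (3 * (`|f| + 1)) by rewrite divr_gt0// mulr_gt0// ltr_wpDl.
  set d := e / _ in d0.
  have De : 3 * d * `|f| <= e.
    have <- : 3 * d * (`|f| + 1) = e.
      by rewrite /d; field; rewrite gt_eqF// ltr_wpDl.
    by rewrite ler_wpM2l ?lerDl// mulr_ge0// ltW.
  have := pos (B + d); rewrite ltr_wpDl// => /(_ isT) h.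
  rewrite (le_trans (h _))//; last by rewrite mulrDr mulrDl addrC lerD2r.
  rewrite (le_trans wB)// lerXn2r ?nnegrE ?lerDl ?(ltW d0)//.
  by rewrite addr_ge0// ltW.
move=> D0 wD.
have := @summing_weights_bound R E q n x w x1 w0 xw (fun k => b k / D).
move=> /(_ (fun k => divr_ge0 (b0 k) (ltW D0))) bound.
have {}bound z : `|z| <= 1 -> \sum_k b k / D * `|x k z| <= 3.
  apply: bound; under eq_bigr do rewrite expr_div_n mulrA.
  by rewrite -mulr_suml ler_pdivrMr ?exprn_gt0// mul1r.
have yw : weakly1 (fun k => (b k / (3 * D)) *: x k).
  move=> z /bound; rewrite -[X in _ <= X -> _]mulr1 -ler_pdivrMl// mulr_sumr;
    apply: le_trans.
  apply: ler_sum => k _;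
    rewrite dualZ normrM ger0_norm ?divr_ge0 ?mulr_ge0 ?(ltW D0)//.
  by rewrite invfM mulrCA -!mulrA.
have := Hfin_le_norm f yw.
under eq_bigr do rewrite Hfin_poshom ?normrM ?divr_ge0 ?mulr_ge0 ?(ltW D0)//.
have D30 : 0 < 3 * D by rewrite mulr_gt0.
move=> h; rewrite -ler_pdivrMl//; apply: le_trans h.
rewrite mulr_sumr; apply: ler_sum => k _.
rewrite (ger0_norm (b0 k)) normfV (gtr0_norm D30) [leRHS]mulrAC.
by rewrite mulrC.
Qed.

(** The [lp] norm at each [x k] is written with norming coefficients [c k]. For fixed [i] the
    weighted bound costs [g i], the [w]-weighted norm of exponent [r] of [c _ i]; since
    [\sum_i g i ^+ r <= W <= W ^+ r], the Hoelder inequality over [i] finishes. *)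
Lemma Hfin_lp_convex m (f : 'I_m -> Hfin E) n (x : 'I_n -> dual E) :
  weakly1 x ->
  \sum_k lp (2 * q.+1) (fun i => f i (x k)) <=
    3 * W * lp (2 * q.+1) (fun i => `|f i|).
Proof.
move=> /weakly1P x1; set r := (2 * q.+1)%N.
have r2 : (1 < r)%N by rewrite /r mulnS.
have W1 : 1 <= W by rewrite /W lerDr mulr_ge0.
have W0 : 0 <= W by exact: le_trans W1.
have [w [w0 wW xw]] := exists_summing_weights q_even summing x1.
have /choice[c cP] k := lp_norming r2 (fun i => f i (x k)).
pose g i := (\sum_k w k * c k i ^+ r) `^ r%:R^-1.
have c0 k i : 0 <= c k i by case: (cP k).
have s0 i : 0 <= \sum_k w k * c k i ^+ r.
  by rewrite sumr_ge0// => k _; rewrite mulr_ge0 ?exprn_ge0.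
have g0 i : 0 <= g i by exact: powR_ge0.
have gr i : g i ^+ r = \sum_k w k * c k i ^+ r.
  rewrite -powR_mulrn// -powRrM mulVf ?powRr1// pnatr_eq0 -lt0n.
  exact: ltnW.
have -> : \sum_k lp r (fun i => f i (x k)) = \sum_i \sum_k c k i * `|f i (x k)|.
  by rewrite exchange_big/=; apply: eq_bigr => k _; case: (cP k).
apply: (@le_trans _ _ (\sum_i 3 * (g i * `| `|f i| |))).
  apply: ler_sum => i _; rewrite normr_id mulrA.
  by apply: (Hfin_weighted_sum_le x1 w0 xw) => //; rewrite gr.
rewrite -mulr_sumr -mulrA ler_wpM2l//.
apply: lp_hoelder => //.
under eq_bigr do rewrite gr.
rewrite exchange_big/= (@le_trans _ _ W)//; last first.
  by rewrite -[leLHS]expr1 ler_weXn2l// ltnW.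
rewrite (le_trans _ wW)//; apply: ler_sum => k _.
by rewrite -mulr_sumr ler_piMr//; case: (cP k).
Qed.

End Hfin_lp.

(** * Functional calculus and p-convexity *)

Lemma continuous_sum {R : realType} {T : topologicalType} I (r : seq I)
    (f : I -> T -> R) :
  (forall i, continuous (f i)) -> continuous (fun t => \sum_(i <- r) f i t).
Proof.
move=> fc; elim: r => [|i r IHr] t.
  by under eq_fun do rewrite big_nil; exact: cvg_cst.
by under eq_fun do rewrite big_cons; exact: (cvgD (fc i t) (IHr t)).
Qed.

Section hom_continuous_closure.
Context {R : realType} {n : nat}.
Implicit Types f g : 'rV[R]_n -> R.

Lemma hom_continuous0 : hom_continuous (fun _ : 'rV[R]_n => 0).
Proof. by split=> [|a t _]; [exact: cst_continuous|rewrite mulr0]. Qed.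

Lemma hom_continuous_lin a f g : hom_continuous f -> hom_continuous g ->
  hom_continuous (fun t => a * f t + g t).
Proof.
move=> [fc fh] [gc gh]; split=> [t|b t b0]; last by rewrite fh// gh//; ring.
exact: (cvgD (cvgM (cvg_cst a) (fc t)) (gc t)).
Qed.

Lemma hom_continuous_coord k : hom_continuous (fun t : 'rV[R]_n => t 0 k).
Proof. by split=> [|a t _]; [exact: coord_continuous|rewrite mxE]. Qed.

Lemma hom_continuous_abs f : hom_continuous f ->
  hom_continuous (fun t => `|f t|).
Proof.
move=> [fc fh]; split=> [t|b t b0]; last by rewrite fh// normrM ger0_norm.
exact: (cvg_norm (fc t)).
Qed.

Lemma hom_continuousD f g : hom_continuous f -> hom_continuous g ->
  hom_continuous (fun t => f t + g t).
Proof.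
move=> fh gh; have := hom_continuous_lin 1 fh gh.
by under eq_fun do rewrite mul1r.
Qed.

Lemma hom_continuous_sum I (r : seq I) (f : I -> 'rV[R]_n -> R) :
  (forall i, hom_continuous (f i)) ->
    hom_continuous (fun t => \sum_(i <- r) f i t).
Proof.
move=> fh; elim: r => [|i r IHr].
  by under eq_fun do rewrite big_nil; exact: hom_continuous0.
by under eq_fun do rewrite big_cons; exact: hom_continuousD.
Qed.

Lemma hom_continuous_lp r : (1 < r)%N ->
  hom_continuous (fun t : 'rV[R]_n => lp r (fun k => t 0 k)).
Proof.
move=> r2; split=> [t|a t a0]; last first.
  rewrite -(lpZ r2 (fun k => t 0 k) a0).
  by congr (lp _ _); apply/funext => k; rewrite mxE.
have t_filter : ProperFilter (nbhs (t : 'rV[R]_n)) by exact: nbhs_pfilter.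
have dt0 : (fun s : 'rV[R]_n => \sum_k `|s 0 k - t 0 k|) @ t --> (0 : R).
  have c : continuous (fun s : 'rV[R]_n => \sum_k `|s 0 k - t 0 k|).
    apply: continuous_sum => k s.
    exact: (cvg_norm (cvgB (@coord_continuous _ 1 n 0 k s) (cvg_cst (t 0 k)))).
  by have := c t; rewrite /continuous_at big1 // => k _; rewrite subrr normr0.
apply/cvgrPdist_le => e e0.
apply: filterS (cvgr0_norm_le _ dt0 _ e0) => s.
rewrite ger0_norm ?sumr_ge0// => /(le_trans _); apply.
have ts := lp_lipschitz r2 (fun k => t 0 k) (fun k => s 0 k).
have st := lp_lipschitz r2 (fun k => s 0 k) (fun k => t 0 k).
rewrite [X in _ + X](eq_bigr (fun k => `|s 0 k - t 0 k|)) in st; last first.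
  by move=> k _; rewrite distrC.
by rewrite ler_norml lerBlDl st andbT lerNl opprB lerBlDl ts.
Qed.

End hom_continuous_closure.

Section calculus_values.
Context {R : realType} {n : nat}.
Variables (c : 'I_n -> R) (psi : ('rV[R]_n -> R) -> R).
Hypothesis psi_lin : forall a f g, hom_continuous f -> hom_continuous g ->
  psi (fun t => a * f t + g t) = a * psi f + psi g.
Hypothesis psi_max : forall f g, hom_continuous f -> hom_continuous g ->
  psi (fun t => Num.max (f t) (g t)) = Num.max (psi f) (psi g).
Hypothesis psi_coord : forall k, psi (fun t => t 0 k) = c k.
Implicit Types f g : 'rV[R]_n -> R.

Let psi0 : psi (fun=> 0) = 0.
Proof.
have := psi_lin 1 hom_continuous0 hom_continuous0.
under eq_fun do rewrite mulr0 addr0.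
by rewrite mul1r => /eqP;
  rewrite -subr_eq0 opprD addrA subrr sub0r oppr_eq0 => /eqP.
Qed.

Let psiZ a f : hom_continuous f -> psi (fun t => a * f t) = a * psi f.
Proof.
move=> fh; have := psi_lin a fh hom_continuous0; rewrite psi0 addr0 => <-.
by congr (psi _); apply/funext => t; rewrite addr0.
Qed.

Let psiD f g : hom_continuous f -> hom_continuous g ->
  psi (fun t => f t + g t) = psi f + psi g.
Proof.
move=> fh gh; have := psi_lin 1 fh gh; rewrite mul1r => <-.
by congr (psi _); apply/funext => t; rewrite mul1r.
Qed.

Let psi_sum (f : 'I_n -> 'rV[R]_n -> R) : (forall i, hom_continuous (f i)) ->
  psi (fun t => \sum_i f i t) = \sum_i psi (f i).
Proof.
move=> fh; elim: (index_enum _) => [|i s IHs].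
  by rewrite big_nil -[RHS]psi0; congr (psi _); apply/funext => t;
    rewrite big_nil.
rewrite big_cons -IHs -psiD//; last exact: hom_continuous_sum.
by congr (psi _); apply/funext => t; rewrite big_cons.
Qed.

Let psi_abs f : hom_continuous f -> psi (fun t => `|f t|) = `|psi f|.
Proof.
move=> fh; have fN := hom_continuous_lin (-1) fh hom_continuous0.
rewrite -(maxrN (psi f)) -mulN1r -[-1 * _]addr0 -[X in _ = Num.max _ (_ +
  X)]psi0.
rewrite -psi_lin -?psi_max//; last exact: hom_continuous0.
by congr (psi _); apply/funext => t; rewrite addr0 mulN1r maxrN.
Qed.

Let psi_le f g : hom_continuous f -> hom_continuous g ->
  (forall t, f t <= g t) -> psi f <= psi g.
Proof.
move=> fh gh fg; have := psi_max fh gh.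
have -> : (fun t => Num.max (f t) (g t)) = g.
  by apply/funext => t; apply/max_idPr.
by move=> ->; rewrite le_max lexx.
Qed.

Lemma calculus_lp_ge0 r : (1 < r)%N ->
  0 <= psi (fun t => lp r (fun k => t 0 k)).
Proof.
move=> r2; rewrite -[leLHS]psi0; apply: psi_le => [||t].
- exact: hom_continuous0.
- exact: hom_continuous_lp.
- exact: lp_ge0.
Qed.

(* With [N] the l1 norm, [N c * lp t] differs from [N t * lp c] by at most
   [\sum_k `|N c * t k - N t * c k|], which the calculus sends to [0]. *)
Lemma calculus_lp_le r : (1 < r)%N ->
  psi (fun t => lp r (fun k => t 0 k)) <= lp r c.
Proof.
move=> r2; pose N (t : 'rV[R]_n) := \sum_k `|t 0 k|.
have cr k := @hom_continuous_coord R n k.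
have hN : hom_continuous N.
  by apply: hom_continuous_sum => k; exact: hom_continuous_abs.
have hlp := @hom_continuous_lp R n r r2.
pose Nc := \sum_k `|c k|.
have psiN : psi N = Nc.
  rewrite psi_sum => [|k]; last exact: hom_continuous_abs.
  by apply: eq_bigr => k _; rewrite psi_abs// psi_coord.
have Nc_ge0 : 0 <= Nc by rewrite sumr_ge0.
(* If all [c k] vanish there is nothing to divide by, but [lp] is then dominated by [N], whose image
   is 0. *)
move: Nc_ge0; rewrite le_eqVlt => /predU1P[Nc0|Nc_gt0].
  rewrite (le_trans _ (lp_ge0 _ _))// Nc0 -psiN; apply: psi_le => // t.
  exact: lp_le_sum.
pose d k (t : 'rV[R]_n) := Nc * t 0 k + (- c k) * N t.
have hd k : hom_continuous (d k).
  apply: hom_continuous_lin => //.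
  have := hom_continuous_lin (- c k) hN hom_continuous0.
  by under eq_fun do rewrite addr0.
have psid k : psi (d k) = 0.
  rewrite psi_lin ?psiZ ?psi_coord ?psiN//; first by ring.
  have := hom_continuous_lin (- c k) hN hom_continuous0.
  by under eq_fun do rewrite addr0.
rewrite -(ler_pM2l Nc_gt0) -psiZ//.
have -> : Nc * lp r c = psi (fun t => lp r c * N t + \sum_k `|d k t|).
  rewrite psi_lin ?psiN//; last first.
    by apply: hom_continuous_sum => k; exact: hom_continuous_abs.
  rewrite (psi_sum (fun k => hom_continuous_abs (hd k))).
  rewrite [X in _ + X]big1 ?addr0 1?[RHS]mulrC// => k _.
  by rewrite psi_abs// psid normr0.
apply: psi_le => [||t].
- have := hom_continuous_lin Nc hlp hom_continuous0.
  by under eq_fun do rewrite addr0.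
- apply: hom_continuous_lin => //; apply: hom_continuous_sum => k.
  exact: hom_continuous_abs.
have Nt0 : 0 <= N t by rewrite sumr_ge0.
rewrite [lp r c * _]mulrC -(lpZ r2 (fun k => t 0 k) (ltW Nc_gt0)) -(lpZ r2 c
  Nt0).
apply: le_trans (lp_lipschitz r2 (fun k => N t * c k) _) _; rewrite lerD2l.
by apply: ler_sum => k _; rewrite /d mulNr [c k * _]mulrC.
Qed.

End calculus_values.

Section FBL_p_convex.
Context {R : realType} {E : normedModType R}.
Variables (q : nat) (C : R).
Hypotheses (q_even : ~~ odd q.+1) (C_ge0 : 0 <= C).
Hypothesis summing : forall (I : finType) (f : I -> dual E),
  (forall z, \sum_i `|f i z| <= `|z|) -> \sum_i `|f i| ^+ q.+1 <= C.

(** Evaluation at a functional turns the abstract calculus into a real-valued one, so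
    [calculus_lp_le] reduces the claim to the pointwise estimate [Hfin_lp_convex]. *)
Lemma FBL_p_convex : p_convex (@conj_exp R (2 * q.+1))%:E (FBL E).
Proof.
exists (3 * (q.+1%:R * C + 1)) => n x tau [tau_lin tau_max tau_coord].
set r := (2 * q.+1)%N; have r2 : (1 < r)%N by rewrite /r mulnS.
apply/Hfin_norm_leP => m y y1.
apply: le_trans (Hfin_lp_convex q_even C_ge0 summing (fun i => FBL_val (x i))
  y1).
apply: ler_sum => k _.
pose psi h := FBL_val (tau h) (y k).
have psi_lin a f g : hom_continuous f -> hom_continuous g ->
    psi (fun t => a * f t + g t) = a * psi f + psi g.
  by move=> fh gh; rewrite /psi tau_lin.
have psi_max f g : hom_continuous f -> hom_continuous g ->
    psi (fun t => Num.max (f t) (g t)) = Num.max (psi f) (psi g).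
  by move=> fh gh; rewrite /psi tau_max.
have psi_coord i : psi (fun t => t 0 i) = FBL_val (x i) (y k).
  by rewrite /psi tau_coord.
have ge0 := calculus_lp_ge0 psi_lin psi_max r2.
rewrite ger0_norm; last exact: ge0.
exact: calculus_lp_le psi_lin psi_max psi_coord r r2.
Qed.

End FBL_p_convex.

(** * Lattice copies of l1 in the free Banach lattice *)

Section FBL_values.
Context {R : realType} {E : normedModType R}.
Implicit Types f g : FBL E.

Definition FBL_eval (x : dual E) f : R := FBL_val f x.

Lemma FBL_eval_linear x : linear (FBL_eval x).
Proof. by []. Qed.

HB.instance Definition _ x :=
  GRing.isLinear.Build R (FBL E) R _ (FBL_eval x) (FBL_eval_linear x).

Lemma FBL_ext f g : (forall x, FBL_eval x f = FBL_eval x g) -> f = g.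
Proof. by move=> fg; do 2 apply/val_inj; apply/funext. Qed.

Lemma FBL_eval_join x f g :
  FBL_eval x (vjoin f g) = Num.max (FBL_eval x f) (FBL_eval x g).
Proof. by []. Qed.

Lemma FBL_eval_meet x f g :
  FBL_eval x (vmeet f g) = Num.min (FBL_eval x f) (FBL_eval x g).
Proof. by []. Qed.

Lemma FBL_normr_le f (c : R) : (`|f| <= c) <->
  forall n (x : 'I_n -> dual E), weakly1 x -> \sum_k `|FBL_eval (x k) f| <= c.
Proof. exact: Hfin_norm_leP. Qed.

Lemma FBL_le_norm f n (x : 'I_n -> dual E) : weakly1 x ->
  \sum_k `|FBL_eval (x k) f| <= `|f|.
Proof. exact: Hfin_le_norm. Qed.

Lemma FBL_delta_subproof (z : E) : delta z \in @FBL_pred R E.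
Proof. by rewrite inE; apply: subset_closure => A [_]; apply; exists z. Qed.

Definition FBL_delta z : FBL E := MkFBL (FBL_delta_subproof z).

Lemma FBL_weak_sum_le n (x : 'I_n -> dual E) (C : R) f : 0 < C ->
  (forall z, \sum_k `|x k z| <= C * `|z|) ->
  \sum_k `|FBL_eval (x k) f| <= C * `|f|.
Proof.
move=> C0 xC; have yw : weakly1 (fun k => C^-1 *: x k).
  apply/weakly1P => z; have := xC z; rewrite -ler_pdivrMl// mulr_sumr.
  apply: le_trans; apply: ler_sum => k _.
  by rewrite dualZ normrM gtr0_norm ?invr_gt0.
have := FBL_le_norm f yw; rewrite -ler_pdivrMl// mulr_sumr; apply: le_trans.
apply: ler_sum => k _; rewrite /FBL_eval Hfin_poshom ?invr_ge0 ?(ltW C0)//.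
by rewrite normrM gtr0_norm ?invr_gt0.
Qed.

End FBL_values.

Section disjoint_copy.
Context {R : realType} {E : normedModType R}.

Section disjoint_family.
Context {n : nat} (y : 'I_n -> E).
Let vabs (g : FBL E) : FBL E := vjoin g (- g).

Definition disjoint_delta (j : 'I_n) : FBL E :=
  vjoin (vabs (FBL_delta (y j)) - \sum_(i | i != j) vabs (FBL_delta (y i))) 0.

Lemma disjoint_deltaE j x : FBL_eval x (disjoint_delta j) =
  Num.max (`|x (y j)| - \sum_(i | i != j) `|x (y i)|) 0.
Proof.
rewrite FBL_eval_join raddf0 raddfB raddf_sum/= FBL_eval_join raddfN maxrN.
congr (Num.max (_ - _) _); apply: eq_bigr => i _.
by rewrite FBL_eval_join raddfN maxrN.
Qed.

Lemma disjoint_delta_ge0 j x : 0 <= FBL_eval x (disjoint_delta j).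
Proof. by rewrite disjoint_deltaE le_max lexx orbT. Qed.

Lemma disjoint_delta_le j x : FBL_eval x (disjoint_delta j) <= `|x (y j)|.
Proof. by rewrite disjoint_deltaE ge_max lerBlDr lerDl sumr_ge0/=. Qed.

Lemma disjoint_delta_disjoint i j x : i != j ->
  FBL_eval x (disjoint_delta i) != 0 -> FBL_eval x (disjoint_delta j) = 0.
Proof.
have pos k : FBL_eval x (disjoint_delta k) != 0 ->
    \sum_(l | l != k) `|x (y l)| < `|x (y k)|.
  rewrite disjoint_deltaE; case: (leP _ 0) => [_|]; first by rewrite eqxx.
  by rewrite subr_gt0.
move=> ij /pos i0; apply/eqP; apply: contraT => /pos j0.
have : `|x (y j)| < `|x (y i)|.
  by apply: le_lt_trans i0; rewrite (bigD1 j) 1?eq_sym//= lerDl sumr_ge0.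
have : `|x (y i)| < `|x (y j)|.
  by apply: le_lt_trans j0; rewrite (bigD1 i)//= lerDl sumr_ge0.
by move=> /lt_trans h /h; rewrite ltxx.
Qed.

Lemma disjoint_delta_norm j : `|y j| <= 1 -> `|disjoint_delta j| <= 1.
Proof.
move=> yj; apply/FBL_normr_le => m x /weakly1P x1.
rewrite (le_trans _ yj)// (le_trans _ (x1 (y j)))//; apply: ler_sum => k _.
by rewrite ger0_norm ?disjoint_delta_ge0// disjoint_delta_le.
Qed.

(** At each [x] at most one term survives, and its factor is nonnegative. *)
Lemma disjoint_sum_max (a b : 'I_n -> R) x :
  \sum_j Num.max (a j) (b j) * FBL_eval x (disjoint_delta j) =
  Num.max (\sum_j a j * FBL_eval x (disjoint_delta j))
          (\sum_j b j * FBL_eval x (disjoint_delta j)).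
Proof.
have [/existsP[i i0]|] := boolP [exists i, FBL_eval x (disjoint_delta i) != 0].
  have only (c : 'I_n -> R) : \sum_j c j * FBL_eval x (disjoint_delta j) =
      c i * FBL_eval x (disjoint_delta i).
    rewrite (bigD1 i)//= big1 ?addr0// => j ji.
    by rewrite (@disjoint_delta_disjoint i j) ?mulr0// eq_sym.
  by rewrite !only maxr_pMl// disjoint_delta_ge0.
rewrite negb_exists => /forallP all0.
have zero (c : 'I_n -> R) : \sum_j c j * FBL_eval x (disjoint_delta j) = 0.
  by rewrite big1// => j _; have := all0 j; rewrite negbK => /eqP ->;
    rewrite mulr0.
by rewrite !zero maxxx.
Qed.

End disjoint_family.

(** Biorthogonality makes [F j] equal to 1 at [f j] and 0 at the other [f k]. Evaluation at the
    [f k] is therefore a left inverse [v] of [u], and a lattice homomorphism because the operations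
    are pointwise; the projection is [u \o v]. *)
Lemma unif_compl_l1_lattice_compl :
  has_unif_compl_l1 E -> has_unif_lattice_compl_l1 (FBL E).
Proof.
move=> /unif_compl_l1_biorthogonal[C0 C00 EC].
(* [FBL_weak_sum_le] divides by the constant, and [C0] may be 0. *)
pose C := C0 + 1; have C1 : 1 <= C by rewrite lerDr.
have C_gt0 : 0 < C by exact: lt_le_trans C1.
exists C => n; have [f [y [y1 fy fC0]]] := EC n.
have fC z : \sum_k `|f k z| <= C * `|z|.
  by rewrite (le_trans (fC0 z))// ler_wpM2r// lerDl.
pose F := disjoint_delta y.
have Ff j k : FBL_eval (f k) (F j) = (j == k)%:R.
  rewrite disjoint_deltaE fy [k == j]eq_sym.
  have [<-|jk] := eqVneq j k.
    rewrite normr1 big1 ?subr0 => [|i ij];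
      last by rewrite fy eq_sym (negbTE ij) normr0.
    by apply/max_idPl.
  rewrite normr0 sub0r; apply/max_idPr; rewrite oppr_le0 sumr_ge0//.
pose u (a : l1 R n) : FBL E := \sum_j (a : 'rV_n) 0 j *: F j.
pose v (g : FBL E) : l1 R n := \row_k FBL_eval (f k) g.
have uE a x : FBL_eval x (u a) = \sum_j (a : 'rV_n) 0 j * FBL_eval x (F j).
  by rewrite raddf_sum.
have u_linear : linear u.
  move=> c a b; rewrite /u scaler_sumr -big_split/=; apply: eq_bigr => j _.
  by rewrite !mxE scalerDl scalerA.
have uv_linear : linear (u \o v).
  move=> c a b /=; rewrite -u_linear; congr u.
  by apply/rowP => k; rewrite !mxE linearP.
have uK : cancel u v.
  move=> a; apply/rowP => k; rewrite mxE uE (bigD1 k)//= Ff eqxx mulr1.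
  by rewrite big1 ?addr0// => j jk; rewrite Ff (negbTE jk) mulr0.
have u_norm a : `|u a| <= 1 * `|a|.
  rewrite mul1r (le_trans (ler_norm_sum _ _ _))//; apply: ler_sum => j _.
  by rewrite normrZ ler_piMr// disjoint_delta_norm.
have v_norm g : `|v g| <= C * `|g|.
  rewrite l1_normE; under eq_bigr do rewrite mxE.
  exact: FBL_weak_sum_le.
have u_join : {morph u : a b / vjoin a b}.
  move=> a b; apply: FBL_ext => x; rewrite FBL_eval_join !uE -disjoint_sum_max.
  by apply: eq_bigr => j _; rewrite mxE.
have u_meet : {morph u : a b / vmeet a b}.
  move=> a b; apply: FBL_ext => x; rewrite FBL_eval_meet !uE.
  rewrite -[Num.min _ _]opprK oppr_min -!sumrN.
  under [in RHS]eq_bigr do rewrite -mulNr.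
  under [X in _ = - Num.max _ X]eq_bigr do rewrite -mulNr.
  rewrite -disjoint_sum_max -sumrN; apply: eq_bigr => j _.
  by rewrite mxE -mulNr oppr_max !opprK.
have v_join g h : v (vjoin g h) = vjoin (v g) (v h).
  by apply/rowP => k; rewrite !mxE.
have v_meet g h : v (vmeet g h) = vmeet (v g) (v h).
  by apply/rowP => k; rewrite !mxE.
exists (linear_of u_linear), (linear_of uv_linear); split.
- by split=> a b /=.
- rewrite -(mul1r C); apply: (@l1_isoI _ _ n _ v) => //; first exact: ltW.
  by move=> a /=; rewrite -{1}(uK a).
- by split=> g h /=; rewrite ?v_join ?v_meet ?u_join ?u_meet.
- split=> [|g /=]; last by rewrite uK.
  apply/seteqP; split=> [_ [g _ <-]|_ [a _ <-]]; first by exists (v g).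
  by exists (u a) => //=; rewrite uK.
- apply/opnorm_leP => [|g /=]; first exact: ltW.
  by rewrite (le_trans (u_norm _))// mul1r.
Qed.

End disjoint_copy.

(** * Copies of l1 against p-convexity *)

Section not_p_convex.
Context {R : realType}.

Lemma lp_norm_delta (p : \bar R) n (i : 'I_n) : (1 < p)%E ->
  lp_norm p (fun k => (delta_mx 0 i : 'rV[R]_n) 0 k) = 1.
Proof.
have d1 : `|(delta_mx 0 i : 'rV[R]_n) 0 i| = 1 by rewrite mxE !eqxx normr1.
have d0 k : k != i -> `|(delta_mx 0 i : 'rV[R]_n) 0 k| = 0.
  by move=> ki; rewrite mxE (negbTE ki) andbF normr0.
case: p => [p||] //=; rewrite ?lte_fin => p1.
  rewrite (bigD1 i)//= d1 big1 ?addr0 ?powR1// => k /d0 ->.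
  by rewrite powR0// gt_eqF// (lt_trans ltr01).
apply/le_anti/andP; split.
  apply/bigmax_leP; split=> // k _; have [->|/d0 ->//] := eqVneq k i.
  by rewrite d1.
by rewrite -[leLHS]d1; exact: le_bigmax.
Qed.

(** One growth exponent covers both cases: [s] is [p^-1] for finite [p] and 0 for [+oo]. Only
    [s < 1] is used later. *)
Lemma lp_norm_bounded (p : \bar R) : (1 < p)%E -> exists2 s : R, s < 1 &
  forall n (t : 'I_n.+1 -> R) c, 0 <= c -> (forall k, `|t k| <= c) ->
    lp_norm p t <= n.+1%:R `^ s * c.
Proof.
case: p => [p||] //=; rewrite ?lte_fin => p1; last first.
  exists 0 => // n t c c0 tc; rewrite powRr0 mul1r.
  by apply/bigmax_leP; split.
have p0 : 0 < p by rewrite (lt_trans ltr01).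
exists p^-1; first by rewrite invf_lt1.
move=> n t c c0 tc.
have -> : n.+1%:R `^ p^-1 * c = (n.+1%:R * c `^ p) `^ p^-1.
  by rewrite powRM ?powR_ge0// -powRrM mulfV ?gt_eqF// powRr1.
apply: ge0_ler_powR; rewrite ?nnegrE ?invr_ge0 ?mulr_ge0 ?powR_ge0 ?(ltW p0)//.
  by rewrite sumr_ge0// => k _; rewrite powR_ge0.
rewrite -[n.+1 in leRHS]card_ord mulr_natl -sumr_const.
by apply: ler_sum => k _; apply: ge0_ler_powR; rewrite ?nnegrE// ltW.
Qed.

Lemma lp_norm_ge0 (p : \bar R) n (t : 'I_n -> R) : 0 <= lp_norm p t.
Proof. by case: p => [p||] /=; rewrite ?powR_ge0//; exact: bigmax_ge_id. Qed.

(* On a sublattice copy of [l1^n] Krivine's calculus at the unit vectors is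
   [tau h = u (\row_i h e_i)], because the unit vectors are disjoint. *)
Lemma l1_sublattices_not_p_convex (X : banachLatticeType R) (p : \bar R) :
  (1 < p)%E -> has_unif_l1_sublattices X -> ~ p_convex p X.
Proof.
move=> p1 [K XK] [M XM].
have [s s1 lps] := lp_norm_bounded p1.
have [n nB] := @natr_powR_unbounded R (1 - s) (`|K| * `|M|) ltac:(by rewrite
  subr_gt0).
case: n nB => [|n nB].
  by rewrite powR0 ?subr_eq0 ?gt_eqF// ltNge mulr_ge0.
have [u [[u_join _] uK]] := XK n.+1.
have uK' := l1_iso_le uK; have [v uv _] := uK.
pose e k : l1 R n.+1 := (delta_mx 0 k : 'rV_n.+1).
pose row_of (h : 'rV[R]_n.+1 -> R) : l1 R n.+1 := \row_i h (delta_mx 0 i).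
pose tau h := u (row_of h).
have tauP : krivine_calculus (fun k => u (e k)) tau.
  split=> [a f g _ _|f g _ _|k].
  - by rewrite /tau -linearP; congr (u _); apply/rowP => i; rewrite !mxE.
  - by rewrite /tau -u_join; congr (u _); apply/rowP => i; rewrite !mxE.
  - by rewrite /tau; congr (u _); apply/rowP => i; rewrite !mxE/= eq_sym.
have := XM _ _ _ tauP; rewrite /tau.
pose b : l1 R n.+1 := (const_mx 1 : 'rV_n.+1).
have -> : row_of (fun t => lp_norm p (fun k => t 0 k)) = b.
  by apply/rowP => i; rewrite !mxE lp_norm_delta.
(* Both estimates of [|u b|] scale with [c]: from below [c * n.+1 / K], from above [M * n.+1^s * c],
   so [c] cancels. *)
have [k0 _ k0P] := @arg_maxP _ R _ ord0 predT (fun k => `|u (e k)|) isT.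
set c := `|u _| in k0P.
have e_norm k : `|e k| = 1.
  rewrite l1_normE (bigD1 k)//= mxE !eqxx normr1 big1 ?addr0// => j jk.
  by rewrite mxE/= (negbTE jk) normr0.
have b_norm : `|b| = n.+1%:R.
  rewrite l1_normE (eq_bigr (fun=> 1)) => [|i _]; last by rewrite mxE normr1.
  by rewrite sumr_const card_ord.
have c0 : 0 < c.
  rewrite normr_gt0; apply/eqP => u0.
  have := uv (e k0); rewrite u0 -(raddf0 u) uv => d0.
  by have := e_norm k0; rewrite -d0 normr0 => /eqP; rewrite eq_sym oner_eq0.
have := uK' (e k0) b; rewrite -/c e_norm b_norm mul1r => lower upper.
have {}upper : `|u b| <= `|M| * (n.+1%:R `^ s * c).
  rewrite (le_trans upper)//
    (@le_trans _ _ (`|M| * lp_norm p (fun k => `|u (e k)|)))//.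
    by rewrite ler_wpM2r ?ler_norm// (lp_norm_ge0 _ _).
  by rewrite ler_wpM2l// lps// => [|k]; [exact: ltW|rewrite normr_id;
    exact: k0P].
have : c * n.+1%:R <= `|K| * (`|M| * (n.+1%:R `^ s * c)).
  rewrite (le_trans lower)// (@le_trans _ _ (`|K| * `|u b|))//.
    by rewrite ler_wpM2r// ler_norm.
  by rewrite ler_wpM2l.
rewrite [_ * c]mulrC [`|M| * _]mulrCA [`|K| * _]mulrCA ler_pM2l//.
move=> le_s; have : n.+1%:R `^ (1 - s) * n.+1%:R `^ s <= `|K| * (`|M| * n.+1%:R
  `^ s).
  rewrite -powRD ?subrK ?powRr1//; apply/implyP => _.
  by rewrite pnatr_eq0.
by rewrite mulrA ler_pM2r ?powR_gt0 ?ltr0n// leNgt nB.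
Qed.

End not_p_convex.

(** * Functional calculus in the free Banach lattice *)

Section lattice_linear_approximation.
Context {R : realType} {N : nat}.
Implicit Types (s t : 'rV[R]_N) (h : 'rV[R]_N -> R).

Let dist1 s t : R := \sum_k `|s 0 k - t 0 k|.
Let cube : set 'rV[R]_N := [set t | forall k, `[-1, 1]%classic (t 0 k)].

Lemma cubeP t : cube t <-> forall k, `|t 0 k| <= 1.
Proof. by split=> tk k; have := tk k; rewrite /= in_itv/= ler_norml. Qed.

Lemma compact_cube : compact cube.
Proof.
by apply: (@rV_compact R N (fun=> `[(-1 : R), 1]%classic)) => _;
  exact: segment_compact.
Qed.

Lemma rV_ballP s t (d : R) : 0 < d ->
  ball t d s <-> forall k, `|t 0 k - s 0 k| < d.
Proof.
move=> d0; split=> [[_ ts] k|ts]; first by have := ts 0 k; rewrite -ball_normE.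
by split=> // i k; rewrite (ord1 i) -ball_normE; exact: ts.
Qed.

Lemma near_coord t (d : R) : 0 < d ->
  \forall s \near t, forall k, `|t 0 k - (s : 'rV[R]_N) 0 k| < d.
Proof.
by move=> d0; apply: filterS (nbhsx_ballx t d d0) => s /(rV_ballP _ _ d0).
Qed.

Lemma continuous_coordP h t (e : R) : continuous h -> 0 < e ->
  exists2 d : R, 0 < d &
    forall s, (forall k, `|t 0 k - s 0 k| < d) -> `|h t - h s| < e.
Proof.
move=> hc e0; have := hc t _ (nbhsx_ballx (h t) e e0).
move=> /nbhs_ballP[d /= d0 dP]; exists d => // s /(rV_ballP _ _ d0)/dP.
by rewrite /= -ball_normE.
Qed.

Lemma continuous_cube_bounded h : continuous h ->
  exists2 B : R, 0 <= B & forall t, cube t -> `|h t| <= B.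
Proof.
move=> hc.
have /compact_near_coveringP cov := compact_cube.
have [m _ mP] : \forall m \near \oo, cube `<=` (fun t => `|h t| <= m%:R).
  apply: cov => x _; have [d d0 dP] := continuous_coordP x hc ltr01.
  have [m0 m0P] := exists_truncn_gt (`|h x| + 1).
  exists ([set t : 'rV[R]_N | forall k, `|x 0 k - t 0 k| < d], [set m | (m0 <=
    m)%N]).
    by split; [exact: near_coord|exists m0].
  move=> [t m] /= [/dP xt m0m].
  rewrite (@le_trans _ _ m0%:R) ?ler_nat// ltW// (le_lt_trans _ m0P)//.
  have := ler_normB (h x) (h x - h t); rewrite subKr => /le_trans; apply.
  by rewrite lerD2l ltW.
by exists m%:R => // t; apply: mP => /=.
Qed.

(** A continuous [h] need not be Lipschitz, hence the term [e]: it covers nearby points, while for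
    distant points [L] times the distance already exceeds the oscillation [2 * B]. *)
Lemma almost_lipschitz_cube h (e : R) : continuous h -> 0 < e ->
  exists2 L : R, 0 <= L & forall s t, cube s -> cube t ->
    `|h s - h t| <= e + L * dist1 s t.
Proof.
move=> hc e0; have [B B0 hB] := continuous_cube_bounded hc.
have /compact_near_coveringP cov := compact_cube.
have [m _ mP] : \forall m \near \oo, cube `<=` (fun t => forall s, cube s ->
    `|h s - h t| <= e + m%:R * dist1 s t).
  apply: cov => x xc; have e2 : 0 < e / 2 by rewrite divr_gt0.
  have [d d0 dP] := continuous_coordP x hc e2.
  have d2 : 0 < d / 2 by rewrite divr_gt0.
  have [m0 m0P] := exists_truncn_gt (2 * B / (d / 2)).
  exists ([set t : 'rV[R]_N | forall k, `|x 0 k - t 0 k| < d / 2],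
          [set m | (m0 <= m)%N]).
    by split; [exact: near_coord|exists m0].
  move=> [t m] /= [xt m0m] s sc.
  have ht : `|h x - h t| < e / 2.
    by apply: dP => k; rewrite (lt_trans (xt k))// ltr_pdivrMr//
      mulr_natr mulr2n ltrDl.
  have tri : `|h s - h t| <= `|h x - h s| + `|h x - h t|.
    by rewrite -[h s - h t](subrKA (h x)) [`|h x - h s|]distrC ler_normD.
  have m0_ge0 : 0 <= m%:R * dist1 s t by rewrite mulr_ge0// sumr_ge0.
  have [near_t|far_t] := ltP (dist1 s t) (d / 2).
    have hs : `|h x - h s| < e / 2.
      apply: dP => k; rewrite -(subrKA (t 0 k)) (le_lt_trans (ler_normD _ _))//.
      rewrite [d]splitr ltrD// (le_lt_trans _ near_t)// distrC.
      by rewrite /dist1 (bigD1 k)//= lerDl sumr_ge0.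
    move: ht hs tri m0_ge0; lra.
  have : 2 * B <= m%:R * dist1 s t.
    rewrite (@le_trans _ _ (m%:R * (d / 2)))//; last by rewrite ler_wpM2l.
    by rewrite -ler_pdivrMr// ltW// (lt_le_trans m0P)// ler_nat.
  have : `|h x - h s| <= 2 * B.
    rewrite (le_trans (ler_normB _ _))// mulr_natl mulr2n lerD//; exact: hB.
  move: ht tri; lra.
by exists m%:R => // s t sc tc; apply: mP => /=.
Qed.

(** The degree-one homogeneous extension of the cone [h s - L * dist1 s t] from the l1 sphere; as a
    function of [t] it is a lattice-linear expression in the coordinates. *)
Definition cone_minorant h (L : R) s t : R :=
  h s * (\sum_k `|t 0 k|) - L * \sum_k `|t 0 k - s 0 k * \sum_j `|t 0 j| |.

Definition grid m : seq 'rV[R]_N :=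
  [seq \row_k (2 * (i k)%:R / m.+1%:R - 1) | i : {ffun 'I_N -> 'I_m.+2}].

Lemma grid_near m t : cube t -> exists2 s, s \in grid m &
  cube s /\ dist1 s t <= N%:R * (2 / m.+1%:R).
Proof.
move=> /cubeP t1; have m0 : 0 < m.+1%:R :> R by rewrite ltr0n.
pose v k : R := (t 0 k + 1) * m.+1%:R / 2.
have v0 k : 0 <= v k.
  rewrite divr_ge0// mulr_ge0// -lerBlDr sub0r.
  by have := t1 k; rewrite ler_norml => /andP[].
have vm k : v k <= m.+1%:R.
  rewrite ler_pdivrMr// mulrC ler_pM2l//.
  by have := t1 k; rewrite ler_norml => /andP[]; lra.
have im k : (Num.truncn (v k) < m.+2)%N.
  rewrite ltnS -(ler_nat R) (le_trans _ (vm k))//.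
  by have /andP[] := truncn_itv (v0 k).
pose i := [ffun k => Ordinal (im k)].
exists (\row_k (2 * (i k)%:R / m.+1%:R - 1)).
  by apply/mapP; exists i; rewrite ?mem_enum.
have bounds k : t 0 k - 2 / m.+1%:R <= 2 * (i k)%:R / m.+1%:R - 1 <= t 0 k.
  have /andP[] := truncn_itv (v0 k); rewrite ffunE/= -natr1 /v.
  set w := (Num.truncn _)%:R => w1 w2.
  apply/andP; split.
    rewrite -(ler_pM2r m0) !mulrBl !divfK ?gt_eqF//; move: w2; lra.
  rewrite -(ler_pM2r m0) !mulrBl !divfK ?gt_eqF//; move: w1; lra.
have lower k : -1 <= 2 * (i k)%:R / m.+1%:R - 1 :> R.
  by rewrite lerBrDr addrC subrr divr_ge0// mulr_ge0.
split.
  apply/cubeP => k; rewrite mxE ler_norml lower/=.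
  have /andP[_ /le_trans] := bounds k; apply.
  by have := t1 k; rewrite ler_norml => /andP[].
rewrite mulr_natl -[N in leRHS]card_ord -sumr_const; apply: ler_sum => k _.
rewrite mxE; have /andP[] := bounds k.
have : 0 <= 2 / m.+1%:R :> R by rewrite divr_ge0.
move: (2 * _ / _ - 1) (2 / _) (t 0 k) => a b c b0 cba ac.
by rewrite ler_norml; apply/andP; split; lra.
Qed.

(** On the l1 sphere every cone with apex on the graph lies below [h] up to the error, and the one
    centred at a nearby grid point comes close to [h]; homogeneity extends both bounds. *)
Lemma lattice_linear_approx h (e : R) : hom_continuous h -> 0 < e ->
  exists (S : seq 'rV[R]_N) (s0 : 'rV[R]_N) (L : R), forall t,
    `|h t - \big[Num.max/cone_minorant h L s0 t]_(s <- S) cone_minorant h L s t|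
      <= e * \sum_k `|t 0 k|.
Proof.
move=> [hc hh] e0.
(* The lower bound loses one third by [hL] and twice [L * dist1 s t'], itself at most a third. *)
have e3 : 0 < e / 3 by rewrite divr_gt0.
have [L L0 hL] := almost_lipschitz_cube hc e3.
have [m mP] := exists_truncn_gt ((L * N%:R * 2 + 1) / (e / 3)).
(* The default 0 of the maximum lies in the cube, so its cone obeys the same upper bound. *)
exists [seq s <- grid m | `[< cube s >]], 0, L => t.
set n := \sum_k `|t 0 k|.
have n0 : 0 <= n by rewrite sumr_ge0.
have zero_cube : cube 0 by apply/cubeP => k; rewrite mxE normr0.
have [t_eq0|t_neq0] := eqVneq n 0.
  have t0 : t = 0.
    apply/rowP => k; rewrite mxE; apply/normr0_eq0/le_anti.
    by rewrite normr_ge0 andbT -t_eq0 /n (bigD1 k)//= lerDl sumr_ge0.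
  have T0 s : cone_minorant h L s t = 0.
    rewrite /cone_minorant -/n t_eq0 mulr0 big1 ?mulr0 ?subr0// => k _.
    by rewrite t0 mulr0 mxE subr0 normr0.
  have -> : h t = 0 by rewrite t0 -(scale0r (0 : 'rV[R]_N)) hh// mul0r.
  rewrite t_eq0 mulr0 sub0r normrN (eq_bigr (fun=> 0)) => [|s _];
    last exact: T0.
  have -> : \big[Num.max/cone_minorant h L 0 t]_(s <- [seq s <- grid m | `[<
    cube s >]]) 0 = 0 :> R.
    by rewrite T0; elim/big_ind: _ => // x y -> ->; rewrite maxxx.
  by rewrite normr0.
have {}n0 : 0 < n by rewrite lt_neqAle eq_sym t_neq0.
pose t' := n^-1 *: t.
have t'1 : \sum_k `|t' 0 k| = 1.
  under eq_bigr do rewrite mxE normrM gtr0_norm ?invr_gt0//.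
  by rewrite -mulr_sumr mulVf.
have t'_cube : cube t'.
  by apply/cubeP => k; rewrite -t'1 (bigD1 k)//= lerDl sumr_ge0.
have tE : t = n *: t' by rewrite scalerA mulfV// scale1r.
have ht : h t = n * h t' by rewrite {1}tE hh// ltW.
have TE s : cone_minorant h L s t = n * (h s - L * dist1 s t').
  rewrite /cone_minorant -/n mulrBr [h s * n]mulrC; congr (_ - _).
  rewrite mulrCA; congr (_ * _); rewrite mulr_sumr; apply: eq_bigr => k _.
  rewrite -{2}(gtr0_norm n0) -normrM distrC mulrBr [n * s 0 k]mulrC.
  by congr `|_ - _|; rewrite mxE mulVKf.
have upper s : cube s -> cone_minorant h L s t <= h t + e * n.
  move=> sc; rewrite TE ht [e * n]mulrC -mulrDr ler_pM2l//.
  have := hL s t' sc t'_cube; rewrite ler_norml => /andP[_].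
  by lra.
have [s sS [sc st]] := grid_near m t'_cube.
have Lst : L * dist1 s t' <= e / 3.
  rewrite (le_trans (ler_wpM2l L0 st))//.
  have m0 : 0 < m.+1%:R :> R by rewrite ltr0n.
  rewrite !mulrA ler_pdivrMr// [leRHS]mulrC -ler_pdivrMr//.
  apply: (@le_trans _ _ m%:R); last by rewrite ler_nat.
  apply: le_trans (ltW mP); by rewrite ler_pM2r ?invr_gt0// lerDl.
have lower : h t - e * n <= cone_minorant h L s t.
  rewrite TE ht [e * n]mulrC -mulrBr ler_pM2l//.
  have := hL s t' sc t'_cube; rewrite ler_norml => /andP[].
  by lra.
set M := \big[_/_]_(_ <- _) _.
have M_le : M <= h t + e * n.
  rewrite /M big_seq; apply: bigmax_le => [|s']; first exact: upper.
  by rewrite mem_filter => /andP[/asboolP s'c _]; exact: upper.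
have M_ge : h t - e * n <= M.
  apply: le_trans lower _; rewrite /M.
  apply: (le_bigmax_seq _ s predT (fun s => cone_minorant h L s t)) => //.
  by rewrite mem_filter sS andbT; exact/asboolP.
by rewrite ler_norml; apply/andP; split; lra.
Qed.

End lattice_linear_approximation.

Section FBL_calculus.
Context {R : realType} {E : normedModType R} {N : nat}.
Variable f : 'I_N -> FBL E.

Let point x : 'rV[R]_N := \row_i FBL_eval x (f i).
Let calculable (h : 'rV[R]_N -> R) :=
  exists g : FBL E, forall x, FBL_eval x g = h (point x).

Let calculable_coord k : calculable (fun t => t 0 k).
Proof. by exists (f k) => x; rewrite mxE. Qed.

Let calculableZ a h : calculable h -> calculable (fun t => a * h t).
Proof. by move=> [g gh]; exists (a *: g) => x; rewrite linearZ/= gh. Qed.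

Let calculableB h h' : calculable h -> calculable h' ->
  calculable (fun t => h t - h' t).
Proof. by move=> [g gh] [g' gh']; exists (g - g') => x;
  rewrite raddfB/= gh gh'. Qed.

Let calculable_max h h' : calculable h -> calculable h' ->
  calculable (fun t => Num.max (h t) (h' t)).
Proof.
by move=> [g gh] [g' gh']; exists (vjoin g g') => x;
  rewrite FBL_eval_join gh gh'.
Qed.

Let calculable_abs h : calculable h -> calculable (fun t => `|h t|).
Proof.
move=> [g gh]; exists (vjoin g (- g)) => x.
by rewrite FBL_eval_join raddfN/= gh maxrN.
Qed.

Let calculable_sum (h : 'I_N -> 'rV[R]_N -> R) : (forall k, calculable (h k)) ->
  calculable (fun t => \sum_k h k t).
Proof.
move=> /choice[g gh]; exists (\sum_k g k) => x.
by rewrite raddf_sum; apply: eq_bigr => k _; exact: gh.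
Qed.

Let calculable_bigmax I (S : seq I) (h0 : 'rV[R]_N -> R) (h : I ->
  'rV[R]_N -> R) :
  calculable h0 -> (forall s, calculable (h s)) ->
  calculable (fun t => \big[Num.max/h0 t]_(s <- S) h s t).
Proof.
move=> c0 c; elim: S => [|s S IHS].
  by under eq_fun do rewrite big_nil.
by under eq_fun do rewrite big_cons; exact: calculable_max.
Qed.

Let calculable_l1 : calculable (fun t => \sum_k `|t 0 k|).
Proof. by apply: calculable_sum => k; exact: calculable_abs. Qed.

Let calculable_cone_minorant h L s : calculable (cone_minorant h L s).
Proof.
apply: calculableB; apply: calculableZ => //; apply: calculable_sum => k.
by apply: calculable_abs; apply: calculableB => //; exact: calculableZ.
Qed.

(** The approximants are lattice-linear in the [f k], hence in [FBL E], with pointwise error at most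
    [e] times the fixed element [n], the sum of the absolute values of the [f k]. They thus converge
    in norm, and [FBL E] is closed. *)
Lemma FBL_calculus (h : 'rV[R]_N -> R) : hom_continuous h ->
  exists g : FBL E, forall x, FBL_eval x g = h (\row_i FBL_eval x (f i)).
Proof.
move=> hh; have [n nE] := calculable_l1.
have approx (e : R) : 0 < e -> exists g : FBL E,
    forall x, `|h (point x) - FBL_eval x g| <= e * `|FBL_eval x n|.
  move=> e0; have [S [s0 [L hS]]] := lattice_linear_approx hh e0.
  have [g gE] := @calculable_bigmax _ S _ _
    (calculable_cone_minorant h L s0) (calculable_cone_minorant h L).
  exists g => x; rewrite gE (le_trans (hS _))// nE ger0_norm ?sumr_ge0//.
have H_fin : (fun x => h (point x)) \in @Hfin_pred R E.
  have [g gE] := approx 1 ltr01.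
  apply: (@Hfin_pred_sum2 R E (FBL_val g) (FBL_val n) _ 1 1) => //.
  - exact: Hfin_funP.
  - exact: Hfin_funP.
  - move=> a x a0; rewrite -hh.2//; congr h; apply/rowP => k.
    by rewrite !mxE /FBL_eval Hfin_poshom.
  move=> x; rewrite mul1r -[h _](subrK (FBL_eval x g)) addrC.
  by rewrite (le_trans (ler_normD _ _))// lerD2l.
pose H := HFin H_fin.
have H_mem : H \in @FBL_pred R E.
  rewrite inE ((closure_id _).1 (@closed_closure _ _)).
  apply/Hfin_closureP => e e0.
  have n1 : 0 < `|n| + 1 by rewrite ltr_wpDl.
  have [g gE] := approx (e / (`|n| + 1)) (divr_gt0 e0 n1).
  exists (FBL_val g); first by have := FBL_valP g; rewrite inE.
  apply: (@le_lt_trans _ _ (e / (`|n| + 1) * `|n|)); last first.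
    by rewrite mulrAC ltr_pdivrMr// ltr_pM2l// ltrDl.
  have := @Hfin_norm_sum2 R E (FBL_val n) 0 (H - FBL_val g) (e / (`|n| + 1)) 0.
  rewrite mul0r addr0; apply=> //; first by rewrite divr_ge0// ltW.
  by move=> x; rewrite mul0r addr0; exact: gE.
by exists (MkFBL H_mem).
Qed.

End FBL_calculus.

(** * Riesz products *)

Section riesz_product.
Context {R : realType} {N : nat}.
Implicit Types (e : {ffun 'I_N -> bool}) (v : 'I_N -> R) (t : 'rV[R]_N).

Let sgn e j : R := (-1) ^+ (e j).

(** With factors [1 + i e_j v_j] the squared modulus is the product of the [1 + v_j^2], controlled
    by the l2 norm of [v]; the real products of [1 + e_j v_j] need not stay bounded on the l2 ball.
    The imaginary part keeps the terms linear in [v]. *)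
Definition riesz v e : R[i] := \prod_j Complex 1 (sgn e j * v j).

Definition norm_sqr (z : R[i]) : R := complex.Re z ^+ 2 + complex.Im z ^+ 2.

Lemma norm_sqrM z w : norm_sqr (z * w) = norm_sqr z * norm_sqr w.
Proof. by case: z w => [a b] [c d]; rewrite /norm_sqr/=; ring. Qed.

Lemma Im_riesz_le v e : \sum_j v j ^+ 2 <= 1 ->
  `|complex.Im (riesz v e)| <= expR 1.
Proof.
move=> v1; have e1 : 1 <= expR 1 :> R by rewrite -[leLHS]expR0 ler_expR.
have riesz_norm : norm_sqr (riesz v e) <= expR 1.
  have -> : norm_sqr (riesz v e) = \prod_j (1 + v j ^+ 2).
    rewrite /riesz (big_morph _ norm_sqrM (_ : norm_sqr 1 = 1)); last first.
      by rewrite /norm_sqr/= expr0n expr1n addr0.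
    apply: eq_bigr => j _; rewrite /norm_sqr/= expr1n exprMn.
    by rewrite sqrr_sign mul1r.
  apply: (@le_trans _ _ (\prod_j expR (v j ^+ 2))).
    by apply: ler_prod => j _; rewrite expR_ge1Dx addr_ge0// sqr_ge0.
  by rewrite -expR_sum ler_expR.
rewrite -(@ler_pXn2r _ 2)// ?nnegrE ?expR_ge0// real_normK ?num_real//.
apply: (@le_trans _ _ (norm_sqr (riesz v e))).
  by rewrite /norm_sqr lerDr sqr_ge0.
by rewrite (le_trans riesz_norm)// expr2 ler_peMr// expR_ge0.
Qed.

Lemma sum_sign_riesz v k :
  \sum_(e : {ffun 'I_N -> bool}) sgn e k * complex.Im (riesz v e) =
  2 ^+ N * v k.
Proof.
(* The sign [sgn e k] goes into the [k]-th factor, so the sum over signs splits into a product of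
   sums over single signs: 2 for [j != k] and [2 i v_k] for [j = k]. *)
pose F j (b : bool) : R[i] :=
  (if j == k then Complex ((-1) ^+ b) 0 else 1) * Complex 1 ((-1) ^+ b * v j).
have FE e : Complex (sgn e k) 0 * riesz v e = \prod_j F j (e j).
  rewrite big_split/= -big_mkcond/= big_pred1_eq.
  by congr (_ * _).
have ImE e : sgn e k * complex.Im (riesz v e) = complex.Im (\prod_j F j (e j)).
  by rewrite -FE; case: (riesz v e) => a b /=; rewrite mul0r addr0.
under eq_bigr do rewrite ImE.
have -> : \sum_(e : {ffun 'I_N -> bool}) complex.Im (\prod_j F j (e j)) =
    complex.Im (\sum_(e : {ffun 'I_N -> bool}) \prod_j F j (e j)).
  by rewrite (big_morph (@complex.Im R) (id1 := 0) (op1 := +%R)) //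
    => -[a b] [c d].
rewrite -(bigA_distr_bigA F).
have sumF j : \sum_b F j b = (2
  : R)%:C%C * (if j == k then Complex 0 (v k) else 1).
  rewrite big_bool /F; have [->|_] := eqVneq j k;
    by apply/eqP; rewrite eq_complex/=; apply/andP; split; apply/eqP => /=;
      ring.
rewrite (eq_bigr _ (fun j _ => sumF j)) big_split/= prodr_const card_ord.
rewrite -big_mkcond/= big_pred1_eq -rmorphXn/=.
by rewrite mul0r addr0.
Qed.

Definition l2 t : R := Num.sqrt (\sum_k t 0 k ^+ 2).

Lemma l2_ge0 t : 0 <= l2 t. Proof. exact: sqrtr_ge0. Qed.

Lemma l2_sqr t : l2 t ^+ 2 = \sum_k t 0 k ^+ 2.
Proof. by rewrite sqr_sqrtr// sumr_ge0// => k _; exact: sqr_ge0. Qed.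

Lemma l2_eq0 t : l2 t = 0 -> t = 0.
Proof.
move=> t0; apply/rowP => k; rewrite mxE; apply/eqP; rewrite -sqrf_eq0.
apply/eqP/le_anti; rewrite sqr_ge0 andbT.
have <- : l2 t ^+ 2 = 0 by rewrite t0 expr0n.
by rewrite l2_sqr (bigD1 k)//= lerDl sumr_ge0// => j _; exact: sqr_ge0.
Qed.

Lemma l2Z (a : R) t : 0 <= a -> l2 (a *: t) = a * l2 t.
Proof.
move=> a0; rewrite /l2; under eq_bigr do rewrite mxE exprMn.
by rewrite -mulr_sumr sqrtrM ?sqr_ge0// sqrtr_sqr ger0_norm.
Qed.

Lemma continuous_l2 : continuous l2.
Proof.
move=> t; apply: continuous_comp; last exact: sqrt_continuous.
apply: continuous_sum => k s.
exact: (cvgM (@coord_continuous _ 1 N 0 k s) (@coord_continuous _ 1 N 0 k s)).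
Qed.

(** The degree-one extension from the l2 sphere, where [Im_riesz_le] applies; at 0 the factor [l2 t]
    makes it vanish. *)
Definition riesz_cone e t : R :=
  l2 t * complex.Im (riesz (fun k => t 0 k / l2 t) e).

Lemma riesz_cone_le e t : `|riesz_cone e t| <= expR 1 * l2 t.
Proof.
rewrite normrM (ger0_norm (l2_ge0 t)) mulrC ler_wpM2r ?l2_ge0//.
apply: Im_riesz_le; have [t0|t0] := eqVneq (l2 t) 0.
  by rewrite t0 big1// => k _; rewrite invr0 mulr0 expr0n.
under eq_bigr do rewrite expr_div_n.
by rewrite -mulr_suml -l2_sqr mulfV// expf_neq0.
Qed.

Lemma sum_sign_riesz_cone t k :
  \sum_(e : {ffun 'I_N -> bool}) sgn e k * riesz_cone e t = 2 ^+ N * t 0 k.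
Proof.
under eq_bigr do rewrite mulrCA.
rewrite -mulr_sumr sum_sign_riesz mulrCA; congr (_ * _).
have [t0|t0] := eqVneq (l2 t) 0; last by rewrite mulrC divfK.
by rewrite t0 mul0r (l2_eq0 t0) mxE.
Qed.

Lemma hom_continuous_riesz_cone e : hom_continuous (riesz_cone e).
Proof.
split=> [t|a t]; last first.
  rewrite le_eqVlt => /predU1P[<-|a0].
    by rewrite /riesz_cone l2Z// !mul0r.
  rewrite /riesz_cone l2Z ?(ltW a0)// -mulrA; congr (_ * (_ * complex.Im _)).
  apply: eq_bigr => j _; rewrite mxE; congr (Complex _ (_ * _)).
  by rewrite invfM mulrACA mulfV ?mul1r// gt_eqF.
have t_filter : ProperFilter (nbhs (t : 'rV[R]_N)) by exact: nbhs_pfilter.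
(* At 0 the quotients by [l2] need not converge; the bound [riesz_cone_le] gives continuity
   there. *)
have [t0|t0] := eqVneq (l2 t) 0.
  have l2_cvg : {for t, continuous (fun s => expR 1 * l2 s)}.
    exact: (cvgM (cvg_cst (expR 1 : R)) (@continuous_l2 t)).
  rewrite /prop_for /continuous_at t0 mulr0 in l2_cvg.
  have rt0 : riesz_cone e t = 0 by rewrite /riesz_cone t0 mul0r.
  apply/cvgrPdist_le => d d0.
  apply: filterS (cvgr0_norm_le _ l2_cvg _ d0) => s.
  rewrite rt0 sub0r normrN; apply: le_trans.
  by rewrite (le_trans (riesz_cone_le e s))// ler_norm.
pose c j (s : 'rV[R]_N) := sgn e j * (s 0 j / l2 s).
have c_cvg j : {for t, continuous (c j)}.
  exact: (cvgM (cvg_cst (sgn e j))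
    (cvgM (@coord_continuous _ 1 N 0 j t) (cvgV t0 (@continuous_l2 t)))).
pose z (r : seq 'I_N) (s : 'rV[R]_N) := \prod_(j <- r) Complex 1 (c j s).
(* Real and imaginary parts are treated together, since multiplying by one more factor mixes
   them. *)
have z_cvg r : {for t, continuous (fun s => complex.Re (z r s))} /\
    {for t, continuous (fun s => complex.Im (z r s))}.
  elim: r => [|j r [IHre IHim]].
    have -> : (fun s => complex.Re (z [::] s)) = cst 1.
      by apply/funext => s; rewrite /z big_nil.
    have -> : (fun s => complex.Im (z [::] s)) = cst 0.
      by apply/funext => s; rewrite /z big_nil.
    by split; exact: cvg_cst.
  have zE s : z (j :: r) s = Complex (complex.Re (z r s) - c j s * complex.Im
    (z r s))
      (complex.Im (z r s) + c j s * complex.Re (z r s)).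
    rewrite /z big_cons; case: (\prod_(_ <- _) _) => a b.
    by apply/eqP; rewrite eq_complex/= !mul1r !eqxx.
  have -> : (fun s => complex.Re (z (j :: r) s)) =
      fun s => complex.Re (z r s) - c j s * complex.Im (z r s).
    by apply/funext => s; rewrite zE.
  have -> : (fun s => complex.Im (z (j :: r) s)) =
      fun s => complex.Im (z r s) + c j s * complex.Re (z r s).
    by apply/funext => s; rewrite zE.
  split; first exact: (cvgB IHre (cvgM (c_cvg j) IHim)).
  exact: (cvgD IHim (cvgM (c_cvg j) IHre)).
exact: (cvgM (@continuous_l2 t) (z_cvg _).2).
Qed.

End riesz_product.

(** * Absence of flat families in the dual of the free Banach lattice *)

Section dual_of_FBL.
Context {R : realType}.

Lemma power_summing_weak (X : normedModType R) q (C : R) :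
  @power_summing R (dual X) q C -> forall (I : finType) (f : I -> dual X),
  (forall z, \sum_i `|f i z| <= `|z|) -> \sum_i `|f i| ^+ q <= C.
Proof.
move=> hC I f f1; apply: hC.
have fe e : `|signsum f e| <= 1.
  by move: e; apply/signsum_le_weak => // z; rewrite mul1r.
rewrite /rad ler_pdivrMl ?exprn_gt0// mulr1.
apply: (@le_trans _ _ (\sum_(e : {ffun I -> bool}) 1)).
  by apply: ler_sum => e _; rewrite expr_le1.
by rewrite sumr_const card_ffun card_bool natrX.
Qed.

Lemma almost_flat_dual_or_summing (X : normedModType R) :
  @almost_flat R (dual X) \/ exists q (C : R), [/\ ~~ odd q.+1, 0 <= C &
    forall (I : finType) (f : I -> dual X),
    (forall z, \sum_i `|f i z| <= `|z|) -> \sum_i `|f i| ^+ q.+1 <= C].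
Proof.
have [|[[|q] [C [//= _ q_even C0 hC]]]]
  := @almost_flat_or_power_summing R (dual X).
  by left.
right; exists q, C; split=> //; exact: power_summing_weak.
Qed.

Variable E : normedModType R.
Variables (q : nat) (C : R).
Hypotheses (q_even : ~~ odd q.+1) (C_ge0 : 0 <= C).
Hypothesis summing : forall (I : finType) (f : I -> dual E),
  (forall z, \sum_i `|f i z| <= `|z|) -> \sum_i `|f i| ^+ q.+1 <= C.

Let r := (2 * q.+1)%N.
Let M := 3 * (q.+1%:R * C + 1).

(** At each functional the Riesz cone is at most [expR 1] times the l2 norm, hence the [lp] norm, of
    the values of [f]; [Hfin_lp_convex] sums this. *)
Lemma FBL_riesz_norm N (f : 'I_N -> FBL E) (g : FBL E) (e : {ffun 'I_N ->
  bool}) :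
  (forall x, FBL_eval x g = riesz_cone e (\row_i FBL_eval x (f i))) ->
  `|g| <= expR 1 * (M * lp r (fun i => `|f i|)).
Proof.
move=> gE; apply/FBL_normr_le => n x x1.
rewrite (@le_trans _ _ (expR 1 * \sum_k lp r (fun i => FBL_eval (x k) (f
  i))))//; last first.
  rewrite ler_wpM2l ?expR_ge0//.
  exact: (Hfin_lp_convex q_even C_ge0 summing (fun i => FBL_val (f i)) x1).
rewrite mulr_sumr; apply: ler_sum => k _; rewrite gE.
rewrite (le_trans (riesz_cone_le _ _))// ler_wpM2l ?expR_ge0//.
have r2 : (1 < r)%N by rewrite /r mulnS.
apply: le_trans (l2_le_lp r2 _); rewrite /l2.
by under eq_bigr do rewrite mxE.
Qed.

Lemma summing_FBL_dual_not_almost_flat : ~ @almost_flat R (dual (FBL E)).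
Proof.
move=> flat; have r2 : (1 < r)%N by rewrite /r mulnS.
have p1 : (1 < (@conj_exp R r)%:E)%E by rewrite lte_fin conj_exp_gt1.
have [s s1 lps] := lp_norm_bounded p1.
have M0 : 0 <= M by rewrite mulr_ge0// addr_ge0// mulr_ge0.
(* With tolerance 1/2 the sign sums are at most 3/2 and each [phi k (f k)] exceeds 1/4, so
   [6 = 4 * (3/2)]. *)
have [N nB] := @natr_powR_unbounded R (1 - s) (6 * (expR 1 * M))
  ltac:(by rewrite subr_gt0).
have B0 : 0 <= 6 * (expR 1 * M) by rewrite mulr_ge0// mulr_ge0// expR_ge0.
case: N nB => [|N nB].
  by rewrite powR0 ?subr_eq0 ?gt_eqF// ltNge B0.
have d1 : 0 < (2^-1 : R) < 1 by apply/andP; split; lra.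
have [phi [phi1 phi_signs]] := flat N.+1 _ d1.
have /choice[f fP] k : exists f, `|f| <= 1 /\ 4^-1 < phi k f.
  have [||f f1 pf] := @exists_norming _ _ (phi k) 4^-1; [by []| |by exists f].
  by apply: lt_le_trans (phi1 k); lra.
have /choice[g gE] e := FBL_calculus f (hom_continuous_riesz_cone e).
have g_norm e : `|g e| <= expR 1 * (M * N.+1%:R `^ s).
  rewrite (le_trans (FBL_riesz_norm (gE e)))// ler_wpM2l ?expR_ge0//
    ler_wpM2l//.
  by rewrite -[leRHS]mulr1 lps// => k; rewrite normr_id; case: (fP k).
have sumE k : \sum_(e : {ffun 'I_N.+1 ->
  bool}) (-1) ^+ e k *: g e = 2 ^+ N.+1 *: f k.
  apply: FBL_ext => x.
  transitivity (2 ^+ N.+1 * FBL_eval x (f k)); last by rewrite linearZ.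
  rewrite linear_sum/=;
    have := sum_sign_riesz_cone (\row_i FBL_eval x (f i)) k; rewrite mxE => <-.
  by apply: eq_bigr => e _; rewrite linearZ/= gE.
(* Exchanging the sums moves the signs from the Riesz products to the [phi k], whose sign sums are
   bounded by flatness. *)
have main : 2 ^+ N.+1 * \sum_k phi k (f k) =
    \sum_(e : {ffun 'I_N.+1 -> bool}) signsum phi e (g e).
  under [RHS]eq_bigr do rewrite signsum_apply.
  rewrite exchange_big/= mulr_sumr; apply: eq_bigr => k _.
  transitivity (phi k (2 ^+ N.+1 *: f k)); first by rewrite linearZ.
  by rewrite -sumE linear_sum/=; apply: eq_bigr => e _; rewrite linearZ.
have upper : \sum_k phi k (f k) <= (1 + 2^-1) * (expR 1 * (M * N.+1%:R `^ s)).
  have p2 : 0 < 2 ^+ N.+1 :> R by rewrite exprn_gt0.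
  rewrite -(ler_pM2l p2) main.
  apply: (@le_trans _ _ (\sum_(e : {ffun 'I_N.+1 -> bool})
      (1 + 2^-1) * (expR 1 * (M * N.+1%:R `^ s)))).
    apply: ler_sum => e _; rewrite (le_trans (ler_norm _))//.
    rewrite (le_trans (dual_normr_apply_le _ _))// ler_pM//.
  by rewrite sumr_const card_ffun card_bool card_ord -[leLHS]mulr_natl natrX.
have lower : N.+1%:R / 4 <= \sum_k phi k (f k).
  rewrite -[N.+1 in leLHS]card_ord mulr_natl -sumr_const.
  by apply: ler_sum => k _; apply/ltW; case: (fP k).
have Ns : N.+1%:R = N.+1%:R `^ (1 - s) * N.+1%:R `^ s :> R.
  rewrite -powRD ?subrK ?powRr1//; apply/implyP => _.
  by rewrite pnatr_eq0.
have Ns0 : 0 < N.+1%:R `^ s :> R by rewrite powR_gt0 ?ltr0n.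
have : 6 * (expR 1 * (M * N.+1%:R `^ s)) < N.+1%:R.
  by rewrite [ltRHS]Ns (mulrA (expR 1)) mulrA ltr_pM2r.
move: (le_trans lower upper); move: (expR 1 * (M * _)) => a; lra.
Qed.

End dual_of_FBL.

Theorem corollary9p25 (R : realType) (E : completeNormedModType R)
  (infE : infinite_dimensional E) :
  [<-> has_unif_compl_l1 E;
       has_unif_lattice_compl_l1 (FBL E);
       has_unif_l1_sublattices (FBL E);
       trivial_cotype (dual E);
       forall p : \bar R, (1 < p)%E -> ~ p_convex p (FBL E);
       has_unif_compl_l1 (FBL E);
       trivial_cotype (dual (FBL E))].
Proof.
have lattice_sub : has_unif_lattice_compl_l1 (FBL E) ->
  has_unif_l1_sublattices (FBL E).
  by move=> [K EK]; exists K => n; have [u [P [uh uK _ _ _]]] := EK n; exists u.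
have lattice_compl : has_unif_lattice_compl_l1 (FBL E) ->
  has_unif_compl_l1 (FBL E).
  by move=> [K EK]; exists K => n; have [u [P [_ uK _ PP PK]]] := EK n;
    exists u, P.
have sub_not_convex : has_unif_l1_sublattices (FBL E) ->
    forall p : \bar R, (1 < p)%E -> ~ p_convex p (FBL E).
  by move=> sub p p1; exact: l1_sublattices_not_p_convex.
have not_convex_compl : (forall p : \bar R, (1 < p)%E ->
  ~ p_convex p (FBL E)) ->
    has_unif_compl_l1 E.
  move=> notc; apply: almost_flat_unif_compl_l1.
  have [//|[q [C [q_even C0 hC]]]] := almost_flat_dual_or_summing E.
  have := FBL_p_convex q_even C0 hC; move=> /(notc _ _)[].
  by rewrite lte_fin conj_exp_gt1// mulnS.
have compl_trivial (X : normedModType R) : has_unif_compl_l1 X ->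
  trivial_cotype (dual X).
  by move=> /unif_compl_l1_weak[C]; exact: trivial_cotype_of_weak_l1.
tfae.
- exact: unif_compl_l1_lattice_compl.
- exact: lattice_sub.
(* Sublattices of [FBL E] reach the cotype of [dual E] through the failure of p-convexity and
   complemented copies of l1 in [E]. *)
- by move=> /sub_not_convex/not_convex_compl/compl_trivial.
- move=> /trivial_cotype_almost_flat/almost_flat_unif_compl_l1.
  by move=> /unif_compl_l1_lattice_compl/lattice_sub/sub_not_convex.
- by move=> /not_convex_compl/unif_compl_l1_lattice_compl/lattice_compl.
- exact: compl_trivial.
- move=> /trivial_cotype_almost_flat flat; apply: almost_flat_unif_compl_l1.
  have [//|[q [C [q_even C0 hC]]]] := almost_flat_dual_or_summing E.
  by have := summing_FBL_dual_not_almost_flat q_even C0 hC flat.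
Qed.
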